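(* Let $\mathbf{P}\in\mathbb{R}^{N\times N}$ be a diagonal matrix with positive diagonal entries $p_{ii}$, and let $\mathbf{U}\in\mathbb{R}^{N\times s}$ and $\mathbf{U}_\partial\in\mathbb{R}^{N\times m}$ have orthonormal columns. Define $\mathbf{Z}(\mathbf{P})=\mathbf{U}^\top\mathbf{P}\mathbf{U}_\partial$. Let $c,\nu$ be positive integers, and let $\tilde\eta_i=\min\{1,c\,\zeta_i\}$ with $$\zeta_i=\frac{\ell_i(\mathbf{U})\,\ell_i(\mathbf{U}_\partial)}{\sum_{j=1}^N\ell_j(\mathbf{U})\,\ell_j(\mathbf{U}_\partial)},\qquad i=1,\dots,N,$$ where all $\tilde\eta_i>0$. For $t=1,\dots,\nu$ and $i=1,\dots,N$ let $\tilde\gamma_i^{(t)}$ be independent Bernoulli random variables with success probabilities $\tilde\eta_i$, and form the independent diagonal sketches $\mathbf{M}_t$ with diagonal entries $\tilde\gamma_i^{(t)}/\sqrt{\tilde\eta_i}$. Let $\bar{\mathbf{Z}}(\mathbf{P})=\frac1\nu\sum_{t=1}^\nu\mathbf{U}^\top\mathbf{P}^{1/2}\mathbf{M}_t^\top\mathbf{M}_t\mathbf{P}^{1/2}\mathbf{U}_\partial$. Then for any $\epsilon>0$, $$\mathbb{P}\bigl(\|\bar{\mathbf{Z}}(\mathbf{P})-\mathbf{Z}(\mathbf{P})\|\ge\epsilon\bigr)\le2\,\frac{\mathrm{Tr}(\mathbf{V}_{\bar{\mathbf{Z}}})}{\|\mathbf{V}_{\bar{\mathbf{Z}}}\|}\exp\left(-\frac{\epsilon^2/2}{\|\mathbf{V}_{\bar{\mathbf{Z}}}\|+L\,\epsilon/3}\right),$$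 for the symmetric matrix $$\mathbf{V}_{\bar{\mathbf{Z}}}=\frac1\nu\begin{bmatrix}\sum_{i=1}^Np_{ii}^2\bigl(\frac1{\tilde\eta_i}-1\bigr)\ell_i(\mathbf{U}_\partial)\,\mathbf{u}_{(i)}^\top\mathbf{u}_{(i)}&0\\0&\sum_{i=1}^Np_{ii}^2\bigl(\frac1{\tilde\eta_i}-1\bigr)\ell_i(\mathbf{U})\,{\mathbf{u}_\partial}_{(i)}^\top{\mathbf{u}_\partial}_{(i)}\end{bmatrix}$$ and $$L=\frac1{\nu c}\Bigl(\sum_{i=1}^N\ell_i(\mathbf{U})\,\ell_i(\mathbf{U}_\partial)\Bigr)\max_i\left\{\frac{p_{ii}}{\sqrt{\ell_i(\mathbf{U})\,\ell_i(\mathbf{U}_\partial)}}\right\}.$$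
   Context: $\mathbf{u}_{(i)}$ and ${\mathbf{u}_\partial}_{(i)}$ denote the $i$-th rows of $\mathbf{U}$ and $\mathbf{U}_\partial$ (row vectors), and $\ell_i(\mathbf{U})=\|\mathbf{u}_{(i)}\|^2$, $\ell_i(\mathbf{U}_\partial)=\|{\mathbf{u}_\partial}_{(i)}\|^2$ are their leverage scores. $\|\cdot\|$ is the spectral norm and $\mathrm{Tr}$ the trace. *)

(* Defs.v *)
From HB Require Import structures.
From mathcomp Require Import all_boot all_order all_algebra.
From mathcomp Require Import all_classical all_reals all_analysis.

Set Implicit Arguments.
Unset Strict Implicit.
Unset Printing Implicit Defensive.

Import Order.TTheory GRing.Theory Num.Theory.

Local Open Scope classical_set_scope.
Local Open Scope ring_scope.

(* Only used on row and column vectors, where it is the Euclidean norm. *)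
Definition vnorm (R : realType) (m n : nat) (x : 'M[R]_(m, n)) : R :=
  Num.sqrt (\sum_(i < m) \sum_(j < n) x i j ^+ 2).

(* Operator norm induced by the Euclidean norms. The closed ball, rather than
   the unit sphere, keeps the set nonempty when n = 0. *)
Definition spectral_norm (R : realType) (m n : nat) (A : 'M[R]_(m, n)) : R :=
  sup [set vnorm (A *m x) | x in [set x : 'cV[R]_n | vnorm x <= 1]].

Definition orthonormal_cols (R : realType) (m n : nat) (A : 'M[R]_(m, n)) :
  Prop := A^T *m A = 1%:M.

(* Mutual independence: the product rule over every subfamily. *)
Definition mutually_independent (d : measure_display) (T : measurableType d)
    (R : realType) (Pr : probability T R) (I : finType)
    (d' : measure_display) (T' : measurableType d')
    (X : I -> {RV Pr >-> T'}) : Prop :=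
  forall (J : {set I}) (A : I -> set T'), (forall i, measurable (A i)) ->
    Pr (\bigcap_(i in [set` J]) (X i @^-1` A i)) =
    (\prod_(i in J) Pr (X i @^-1` A i))%E.

Section sketching.
Context {R : realType} {N s m : nat}.
Implicit Types (P : 'M[R]_N) (U : 'M[R]_(N, s)) (Ud : 'M[R]_(N, m)).

Definition leverage (k : nat) (A : 'M[R]_(N, k)) (i : 'I_N) : R :=
  vnorm (row i A) ^+ 2.

Definition Zmx P U Ud : 'M[R]_(s, m) := U^T *m P *m Ud.

Definition zeta U Ud (i : 'I_N) : R :=
  leverage U i * leverage Ud i / \sum_(j < N) leverage U j * leverage Ud j.

Definition eta U Ud (c : nat) (i : 'I_N) : R :=
  Num.min 1 (c%:R * zeta U Ud i).

(* The square root of a diagonal P with nonnegative diagonal. *)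
Definition diag_sqrt P : 'M[R]_N := diag_mx (\row_i Num.sqrt (P i i)).

Definition sketch U Ud (c : nat) (g : 'I_N -> bool) : 'M[R]_N :=
  diag_mx (\row_i ((g i)%:R / Num.sqrt (eta U Ud c i))).

Definition Zbar P U Ud (c nu : nat) (g : 'I_nu -> 'I_N -> bool) :
    'M[R]_(s, m) :=
  nu%:R^-1 *: \sum_(t < nu)
    (U^T *m diag_sqrt P *m (sketch U Ud c (g t))^T
      *m sketch U Ud c (g t) *m diag_sqrt P *m Ud).

Definition Vmx P U Ud (c nu : nat) : 'M[R]_(s + m) :=
  nu%:R^-1 *: block_mx
    (\sum_(i < N) (P i i ^+ 2 * ((eta U Ud c i)^-1 - 1) * leverage Ud i)
       *: ((row i U)^T *m row i U))
    0 0
    (\sum_(i < N) (P i i ^+ 2 * ((eta U Ud c i)^-1 - 1) * leverage U i)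
       *: ((row i Ud)^T *m row i Ud)).

(* The maximum is taken over nonnegative terms, so the default value 0 only
   matters when N = 0. *)
Definition Lconst P U Ud (c nu : nat) : R :=
  (nu%:R * c%:R)^-1 * (\sum_(i < N) leverage U i * leverage Ud i) *
  \big[Num.max/0]_(i < N)
    (P i i / Num.sqrt (leverage U i * leverage Ud i)).

End sketching.

(* Main.v *)
(** This is a matrix Bernstein inequality with intrinsic dimension, applied to the
    Hermitian dilation of the error, a sum [Y = \sum_k xi_k *: B_k] of independent
    centred two-valued multiples of fixed symmetric matrices with [B_k ^ 3 = B_k].

    For such scalar multiples Lieb's theorem is not needed.  A two-point estimate
    for [\tr (B *m exp (H + x *: B))] shows that [M th = E (\tr (exp (th *: Y)) - \tr 1)]
    satisfies [M' <= ka th * E (\tr (V *m exp (th *: Y)))] with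
    [ka th = (expR (th * L) - 1) / L].  Since the dilation is odd under a sign
    flip that fixes [V], [exp] may be replaced by [cosh >= 1], so that
    [M' <= ka * (\tr V + v * M)] with [v] the norm of [V].  Integrating gives
    [M th <= \tr V / v * (expR (v * g th) - 1)].  Markov's inequality for
    [expR x - 1 - x] concludes; keeping the two [- 1]'s is what gives the factor 2
    and all [eps > 0]. *)

Require Import Defs.
From mathcomp Require Import all_boot all_order all_algebra.
From mathcomp Require Import all_classical all_reals all_analysis.
From mathcomp Require Import complex ring lra.

Import Order.TTheory GRing.Theory Num.Theory.
Import numFieldNormedType.Exports.

Local Open Scope classical_set_scope.
Local Open Scope ring_scope.

(** * The real spectral theorem *)

(** The two-point estimate rests on a closed pair of differential inequalities. When [B ^ 3 = B],
    the functions [f x = \tr (B *m mexp (H + x *: B))] and [h x = \tr (B *m B *m mexp (H + x *: B))]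
    satisfy [f' <= h] and [h' <= h]. The obstacle is the derivative of a matrix exponential, and it
    is never formed: both inequalities are proved for trapezoidal steps on a grid, and the mesh is
    then refined. Only traces of [mexp (th *: Y)] are differentiated, in [th], where they are finite
    sums of scalar exponentials. The cube identity is available because the dilation of a rank-one
    matrix has at most one nonzero eigenvalue up to sign, which is normalised to 1. *)

(** A complex eigenvalue exists by algebraic closure. Evaluating the Hermitian form of [A] at its
    eigenvector in two ways shows that it is its own conjugate, and the characteristic polynomial
    brings it back to [R]. *)
Lemma sym_has_eigenvalue (R : rcfType) (n : nat) (A : 'M[R]_n) :
  (0 < n)%N -> A^T = A -> exists a, eigenvalue A a.
Proof.
move=> n_gt0 Asym; pose f := real_complex R.
have [a] := @eigenvalue_closed R[i] n (map_mx f A) n_gt0.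
move=> aA; have [v vA v0] := eigenvalueP aA.
have Ac : (map_mx f A)^T = map_mx f A by rewrite map_trmx Asym.
have Aconj : map_mx Num.conj (map_mx f A) = map_mx f A.
  by apply/matrixP => i j; rewrite !mxE; exact: conjc_real.
pose q := (v *m (map_mx Num.conj v)^T) 0 0.
have q0 : q != 0.
  rewrite /q mxE; under eq_bigr do rewrite !mxE -normCK.
  rewrite psumr_eq0; last by move=> i _; rewrite exprn_ge0.
  apply/negP => /allP h; move/negP: v0; apply.
  apply/eqP/rowP => i; rewrite mxE; apply/eqP.
  by have := h i (mem_index_enum _); rewrite expf_eq0 normr_eq0.
have e1 : (v *m map_mx f A *m (map_mx Num.conj v)^T) 0 0 = a * q.
  by rewrite vA -scalemxAl mxE.
have e2 : (v *m map_mx f A *m (map_mx Num.conj v)^T) 0 0 = a^* * q.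
  (* A 1 by 1 matrix equals its transpose, which exchanges [v] and its conjugate. *)
  have -> : (v *m map_mx f A *m (map_mx Num.conj v)^T) =
    (v *m map_mx f A *m (map_mx Num.conj v)^T)^T.
    by apply/matrixP => i j; rewrite !ord1 [RHS]mxE.
  rewrite !trmx_mul trmxK Ac.
  have : map_mx Num.conj (v *m map_mx f A) = map_mx Num.conj (a *: v) by rewrite vA.
  rewrite map_mxM Aconj map_mxZ mulmxA => ->.
  rewrite -scalemxAl mxE; congr (_ * _); rewrite /q !mxE.
  by apply: eq_bigr => i _; rewrite !mxE mulrC.
have areal : a = a^* by apply: (mulIf q0); rewrite -e1 e2.
have {}areal : a \is Num.real by apply/CrealP.
have aE : a = f (complex.Re a) by rewrite /f RRe_real.
exists (complex.Re a).
move: aA; rewrite !eigenvalue_root_char aE -map_char_poly fmorph_root.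
by rewrite -aE.
Qed.

Lemma rowsqE (R : comRingType) (n : nat) (v : 'rV[R]_n) :
  v *m v^T = (\sum_i v 0 i ^+ 2)%:M.
Proof.
apply/matrixP => i j; rewrite !ord1 !mxE.
by apply: eq_bigr => k _; rewrite !mxE expr2.
Qed.

Lemma rowsq_eq0 (R : realDomainType) (n : nat) (v : 'rV[R]_n) :
  (\sum_i v 0 i ^+ 2 == 0) = (v == 0).
Proof.
apply/idP/eqP => [|->]; last by rewrite big1 // => i _; rewrite mxE expr0n.
rewrite psumr_eq0 => [/allP h|i _]; last exact: sqr_ge0.
apply/rowP => i; rewrite mxE; apply/eqP.
by have := h i (mem_index_enum _); rewrite expf_eq0.
Qed.

(* The Householder reflection in the hyperplane orthogonal to [u - v]. *)
Lemma reflection_to (R : rcfType) (n : nat) (u v : 'rV[R]_n) :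
  u *m u^T = 1%:M -> v *m v^T = 1%:M ->
  exists2 H : 'M[R]_n, H^T = H /\ H *m H = 1%:M & u *m H = v.
Proof.
move=> u1 v1; have [->|uv] := eqVneq u v.
  by exists 1%:M; rewrite ?trmx1 ?mulmx1.
have [w wE] : exists w, w = u - v by exists (u - v).
pose q := \sum_i w 0 i ^+ 2.
have q0 : q != 0 by rewrite rowsq_eq0 wE subr_eq0.
have vu : v *m u^T = u *m v^T.
  by apply/matrixP => i j; rewrite !ord1 -[in RHS](trmxK u) -trmx_mul [RHS]mxE.
(* Since [u] and [v] are unit vectors, [u . w = 1 - u . v] is half of [w . w]; hence the coefficient
   [2 / q] below. *)
have uw : u *m w^T = (q / 2)%:M.
  have uwE : u *m w^T = 1%:M - u *m v^T by rewrite wE linearB /= mulmxBr u1.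
  have vwE : v *m w^T = - (u *m w^T).
    by rewrite uwE wE linearB /= mulmxBr v1 vu opprB.
  have : w *m w^T = 2 *: (u *m w^T).
    by rewrite {1}wE mulmxBl vwE opprK scaler_nat mulr2n.
  rewrite rowsqE -/q => /(congr1 ( *:%R 2^-1)); rewrite scalerA mulVf ?pnatr_eq0//.
  by rewrite scale1r => <-; rewrite scale_scalar_mx mulrC.
have ww : w^T *m w *m (w^T *m w) = q *: (w^T *m w).
  by rewrite mulmxA -(mulmxA w^T w) rowsqE mul_mx_scalar -scalemxAl.
pose r := 2 / q.
have rq : r * q = 2 by rewrite /r divfK.
exists (1%:M - r *: (w^T *m w)).
  split; first by rewrite linearB linearZ /= trmx1 trmx_mul trmxK.
  rewrite mulmxBl mul1mx mulmxBr mulmx1 -scalemxAl -scalemxAr scalerA ww scalerA.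
  by rewrite -mulrA rq mulr_natr mulr2n scalerDl opprB addrK subrK.
rewrite mulmxBr mulmx1 -scalemxAr mulmxA uw mul_scalar_mx scalerA mulrA rq.
by rewrite divff ?pnatr_eq0// scale1r wE subKr.
Qed.

(** Deflation: conjugating by a reflection that sends the first basis vector to a unit eigenvector
    splits off a 1 by 1 block, and symmetry clears the rest of its row and column. *)
Lemma sym_diagonalization (R : rcfType) (n : nat) (A : 'M[R]_n) : A^T = A ->
  exists (Q : 'M[R]_n) (l : 'rV[R]_n),
    Q *m Q^T = 1%:M /\ A = Q^T *m diag_mx l *m Q.
Proof.
elim: n A => [|n IHn] A Asym.
  by exists 1%:M, 0; split; apply/matrixP => -[].
have [a /eigenvalueP[x xA x0]] := sym_has_eigenvalue _ _ _ (ltn0Sn n) Asym.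
pose r := Num.sqrt (\sum_i x 0 i ^+ 2).
have r2 : r ^+ 2 = \sum_i x 0 i ^+ 2.
  by rewrite sqr_sqrtr// sumr_ge0// => i _; rewrite sqr_ge0.
have r0 : r != 0 by rewrite -sqrf_eq0 r2 rowsq_eq0.
pose v := r^-1 *: x.
have vA : v *m A = a *: v by rewrite /v -scalemxAl xA !scalerA mulrC.
have v1 : v *m v^T = 1%:M.
  rewrite /v linearZ /= -scalemxAl -scalemxAr scalerA rowsqE -r2.
  by rewrite scale_scalar_mx -expr2 -exprMn mulVf// expr1n.
pose e : 'rV[R]_(1 + n) := row_mx 1%:M 0.
have e1 : e *m e^T = 1%:M.
  by rewrite /e tr_row_mx trmx1 trmx0 mul_row_col mulmx1 mulmx0 addr0.
have [H [Hsym HH] eH] := reflection_to R _ _ _ e1 v1.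
pose A' : 'M[R]_(1 + n) := H *m A *m H.
have A'sym : A'^T = A' by rewrite /A' !trmx_mul Hsym Asym mulmxA.
have eA' : e *m A' = a *: e.
  by rewrite /A' !mulmxA eH vA -scalemxAl -eH -mulmxA HH mulmx1.
have A'E : A' = block_mx a%:M 0 0 (drsubmx A').
  move: eA'; rewrite -{1}(submxK A') /e mul_row_block !mul1mx !mul0mx !addr0.
  rewrite scale_row_mx scaler0 scale_scalar_mx mulr1 => /eq_row_mx[ul ur].
  have dl : dlsubmx A' = 0 by rewrite -A'sym -trmx_ursub ur trmx0.
  by rewrite -{1}(submxK A') ul ur dl.
have [Q [l [Q1 A'd]]] := IHn (drsubmx A') (etrans (trmx_drsub _) (congr1 _ A'sym)).
pose Q' : 'M[R]_(1 + n) := block_mx 1%:M 0 0 Q.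
have Q'T : Q'^T = block_mx 1%:M 0 0 Q^T.
  by rewrite /Q' tr_block_mx !trmx0 trmx1.
have Q'1 : Q' *m Q'^T = 1%:M.
  rewrite Q'T mulmx_block !mulmx0 !mul0mx !mulmx1 !addr0 !add0r Q1.
  by rewrite -scalar_mx_block.
have Q'd : Q'^T *m diag_mx (row_mx a%:M l) *m Q' = A'.
  rewrite A'E A'd diag_mx_row Q'T /Q' !mulmx_block.
  rewrite !mulmx0 !mul0mx !mulmx1 !mul1mx !addr0 !add0r ?mul0mx ?mulmx0.
  by congr block_mx; apply/matrixP => i j; rewrite !ord1 !mxE eqxx.
exists (Q' *m H), (row_mx a%:M l); split.
  by rewrite trmx_mul Hsym mulmxA -(mulmxA Q') HH mulmx1.
have -> : A = H *m A' *m H by rewrite /A' !mulmxA HH mul1mx -mulmxA HH mulmx1.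
by rewrite -Q'd trmx_mul Hsym !mulmxA.
Qed.

(** * The exponential of a symmetric matrix *)

Lemma is_derive_ge0_le (R : realType) (f df : R -> R) (a b : R) :
  (forall x : R, is_derive x 1 f (df x)) -> (forall x, a <= x -> 0 <= df x) ->
  a <= b -> f a <= f b.
Proof.
move=> fdf df0 ab.
have [|c] := @MVT_segment R f df a b ab (fun x _ => fdf x).
  by apply: derivable_within_continuous => x _; case: (fdf x).
rewrite in_itv/= => /andP[ac _] fba.
by rewrite -subr_ge0 fba mulr_ge0 ?df0 ?subr_ge0.
Qed.

(** Convexity: the mean of [expR] over an interval is at most the mean of its endpoint values. After
    division by [expR x] this is a one-variable inequality in [u = y - x]. *)
Lemma expR_secant_le_trapezoid (R : realType) (x y : R) :
  `|expR y - expR x| <= `|y - x| * ((expR x + expR y) / 2).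
Proof.
wlog xy : x y / x <= y.
  move=> h; case/orP: (le_total x y) => [xy|yx]; first exact: (h x y xy).
  by rewrite distrC (distrC y) [expR x + _]addrC; exact: (h y x yx).
have pos (u : R) : 0 <= u -> 0 <= u * (expR u + 1) - 2 * (expR u - 1).
  move=> u0.
  pose f (u : R) := u * (expR u + 1) - 2 * (expR u - 1).
  have f0 : f 0 = 0 by rewrite /f expR0; ring.
  rewrite -[X in X <= _]f0.
  apply: (@is_derive_ge0_le _ f (fun t => 1 + (t - 1) * expR t)) u0.
    move=> t; rewrite /f; apply: is_derive_eq.
    by rewrite /GRing.scale/=; ring.
  move=> t t0; have := expR_ge1Dx (- t); have := expRxMexpNx_1 t.
  have := expR_gt0 t; have := expR_gt0 (- t).
  by move: (expR t) (expR (- t)) => E F; nra.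
rewrite !ger0_norm ?subr_ge0 ?ler_expR//.
have := pos (y - x); rewrite subr_ge0 => /(_ xy).
have -> : expR y = expR x * expR (y - x) by rewrite -expRD; congr expR; ring.
have := expR_gt0 x; move: (y - x) => u; move: (expR x) (expR u) => E F E0 h.
rewrite -subr_ge0 (_ : _ - _ = E / 2 * (u * (F + 1) - 2 * (F - 1))).
  by rewrite mulr_ge0 ?divr_ge0// ltW.
by field.
Qed.

Section MatrixExponential.
Variables (R : realType) (n : nat).
Implicit Types (A B C Q : 'M[R]_n) (l : 'rV[R]_n).

Definition is_eigendec A (Ql : 'M[R]_n * 'rV[R]_n) : Prop :=
  Ql.1 *m Ql.1^T = 1%:M /\ A = Ql.1^T *m diag_mx Ql.2 *m Ql.1.

Definition eigendec A : 'M[R]_n * 'rV[R]_n :=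
  xget (1%:M, 0) [set Ql | is_eigendec A Ql].

(** Functional calculus instead of the power series: every estimate below is read off in eigenbases.
    Independence of the chosen eigenbasis is [mexpE]. *)
Definition mexp A : 'M[R]_n :=
  (eigendec A).1^T *m diag_mx (map_mx expR (eigendec A).2) *m (eigendec A).1.

Lemma eigendecP A : A^T = A -> is_eigendec A (eigendec A).
Proof.
move=> /sym_diagonalization[Q [l Ql]].
by apply: (@xgetPex _ _ [set Ql | is_eigendec A Ql]); exists (Q, l).
Qed.

Lemma eigendec_sym A Ql : is_eigendec A Ql -> A^T = A.
Proof. by case=> _ ->; rewrite !trmx_mul trmxK tr_diag_mx mulmxA. Qed.

(** Each matrix acts diagonally on its own side of the product. The case [A' = A] makes overlaps
    between distinct eigenvalues vanish; the case of a perturbation drives [mxtrace_mexp_step]. *)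
Lemma eigendec_overlap A A' Ql Ql' p q :
  is_eigendec A Ql -> is_eigendec A' Ql' ->
  (Ql.1 *m (A' - A) *m Ql'.1^T) p q
  = (Ql.1 *m Ql'.1^T) p q * (Ql'.2 0 q - Ql.2 0 p).
Proof.
case: Ql Ql' => [Q l] [Q' l'] [/= Q1 ->] [/= Q'1 ->].
rewrite mulmxBr mulmxBl !mulmxA Q1 mul1mx.
rewrite -[Q *m Q'^T *m _ *m _ *m _]mulmxA Q'1 mulmx1 -[diag_mx l *m _ *m _]mulmxA.
by rewrite mul_mx_diag mul_diag_mx !mxE; ring.
Qed.

Lemma mexpE A Ql : is_eigendec A Ql ->
  mexp A = Ql.1^T *m diag_mx (map_mx expR Ql.2) *m Ql.1.
Proof.
move=> AQl; have AQl' := eigendecP _ (eigendec_sym _ _ AQl).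
rewrite /mexp; move: (eigendec A) AQl' => Ql' AQl'.
have W p q : (Ql.1 *m Ql'.1^T) p q * expR (Ql'.2 0 q)
    = expR (Ql.2 0 p) * (Ql.1 *m Ql'.1^T) p q.
  have := eigendec_overlap _ _ _ _ p q AQl AQl'.
  rewrite subrr mulmx0 mul0mx mxE => /esym/eqP.
  rewrite mulf_eq0 => /orP[/eqP->|]; first by rewrite mul0r mulr0.
  by rewrite subr_eq0 => /eqP->; rewrite mulrC.
case: Ql Ql' AQl AQl' W => [Q l] [Q' l'] [/= Q1 _] [/= Q'1 _] W.
have {}W : Q *m Q'^T *m diag_mx (map_mx expR l')
    = diag_mx (map_mx expR l) *m (Q *m Q'^T).
  apply/matrixP => p q; rewrite mul_mx_diag mul_diag_mx !mxE.
  by have := W p q; rewrite !mxE.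
rewrite -[LHS]mul1mx -(mulmx1C Q1) -!mulmxA (mulmxA Q) (mulmxA (Q *m _)) W.
by rewrite -!mulmxA (mulmx1C Q'1) mulmx1.
Qed.

Lemma mxtrace_mul_mexp A C Ql : is_eigendec A Ql ->
  \tr (C *m mexp A) = \sum_p (Ql.1 *m C *m Ql.1^T) p p * expR (Ql.2 0 p).
Proof.
move=> AQl; rewrite (mexpE _ _ AQl) !mulmxA mxtrace_mulC !mulmxA.
by rewrite mul_mx_diag; apply: eq_bigr => p _; rewrite !mxE.
Qed.

Lemma mxtrace_mexp_diff A A' C Ql Ql' :
  is_eigendec A Ql -> is_eigendec A' Ql' ->
  \tr (C *m mexp A') - \tr (C *m mexp A) =
  \sum_p \sum_q (Ql.1 *m C *m Ql'.1^T) p q * (Ql.1 *m Ql'.1^T) p q *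
    (expR (Ql'.2 0 q) - expR (Ql.2 0 p)).
Proof.
move=> AQl A'Ql'; rewrite (mexpE _ _ AQl) (mexpE _ _ A'Ql').
case: Ql Ql' AQl A'Ql' => [Q l] [Q' l'] [/= Q1 _] [/= Q'1 _].
have -> : \tr (C *m (Q'^T *m diag_mx (map_mx expR l') *m Q')) =
    \tr (Q *m C *m Q'^T *m diag_mx (map_mx expR l') *m (Q *m Q'^T)^T).
  rewrite trmx_mul trmxK !mulmxA [RHS]mxtrace_mulC !mulmxA.
  by rewrite (mulmx1C Q1) mul1mx.
have -> : \tr (C *m (Q^T *m diag_mx (map_mx expR l) *m Q)) =
    \tr (diag_mx (map_mx expR l) *m (Q *m C *m Q'^T) *m (Q *m Q'^T)^T).
  rewrite trmx_mul trmxK [LHS]mxtrace_mulC !mulmxA -(mulmxA _ Q'^T Q').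
  by rewrite (mulmx1C Q'1) mulmx1 [RHS]mxtrace_mulC !mulmxA.
rewrite -raddfB/= -mulmxBl; apply: eq_bigr => p _; rewrite mxE.
by apply: eq_bigr => q _; rewrite mul_mx_diag mul_diag_mx !mxE; ring.
Qed.

End MatrixExponential.

Section TraceExponential.
Variables (R : realType) (n : nat).
Implicit Types (A B C K : 'M[R]_n).

(** The basis [Q'] is arbitrary, so traces at [A] can be expanded over the same pairs of
    eigenvectors as traces at a perturbed matrix. *)
Lemma mxtrace_sqr_mexp A C Ql (Q' : 'M[R]_n) :
  is_eigendec R n A Ql -> Q' *m Q'^T = 1%:M -> C^T = C ->
  \tr (C *m C *m mexp R n A)
  = \sum_p \sum_q (Ql.1 *m C *m Q'^T) p q ^+ 2 * expR (Ql.2 0 p).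
Proof.
move=> AQl Q'1 Csym; rewrite (mxtrace_mul_mexp _ _ _ _ _ AQl).
apply: eq_bigr => p _; rewrite -mulr_suml; congr (_ * _).
have -> : Ql.1 *m (C *m C) *m Ql.1^T = Ql.1 *m C *m Q'^T *m (Ql.1 *m C *m Q'^T)^T.
  rewrite !trmx_mul trmxK Csym !mulmxA -(mulmxA _ Q'^T Q') (mulmx1C Q'1).
  by rewrite mulmx1.
by rewrite mxE; apply: eq_bigr => q _; rewrite [X in _ * X]mxE expr2.
Qed.

(* In eigenbases of [A] and [A' = A + e *: B], with overlaps [w_pq], the matrix
   of [e *: B] has entries [w_pq * (l'_q - l_p)]; the secant-trapezoid bound on
   [expR l'_q - expR l_p] and AM-GM then give the inequality without any
   differentiation of the matrix exponential. *)
Lemma mxtrace_mexp_step A B C (e : R) : A^T = A -> B^T = B -> C^T = C ->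
    C *m C = B *m B -> 0 <= e ->
  \tr (C *m mexp R n (A + e *: B)) - \tr (C *m mexp R n A) <=
  e / 2 * (\tr (B *m B *m mexp R n A) + \tr (B *m B *m mexp R n (A + e *: B))).
Proof.
move=> Asym Bsym Csym CB e0.
have A'sym : (A + e *: B)^T = A + e *: B by rewrite linearD linearZ /= Asym Bsym.
have [Ql AQl] : exists Ql, is_eigendec R n A Ql.
  by eexists; exact: eigendecP.
have [Ql' A'Ql'] : exists Ql, is_eigendec R n (A + e *: B) Ql.
  by eexists; exact: eigendecP.
have Q1 := AQl.1; have Q'1 := A'Ql'.1.
rewrite (mxtrace_mexp_diff _ _ _ _ _ _ _ AQl A'Ql').
have swap (D : 'M[R]_n) : D^T = D -> \tr (D *m D *m mexp R n (A + e *: B)) =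
    \sum_p \sum_q (Ql.1 *m D *m Ql'.1^T) p q ^+ 2 * expR (Ql'.2 0 q).
  move=> Dsym; rewrite (mxtrace_sqr_mexp _ _ _ Ql.1 A'Ql')//.
  rewrite exchange_big/=; apply: eq_bigr => p _; apply: eq_bigr => q _.
  congr (_ ^+ 2 * _); transitivity ((Ql'.1 *m D *m Ql.1^T)^T p q).
    by rewrite [RHS]mxE.
  by rewrite !trmx_mul trmxK Dsym mulmxA.
(* Writing [B *m B] as the average of [C *m C] and [B *m B] produces the sum of squares that AM-GM
   needs for the mixed product of entries of [C] and [B]. *)
have half (x y : R) : x = y -> x = x / 2 + y / 2 by move=> <-; rewrite -splitr.
have -> : \tr (B *m B *m mexp R n A) =
    \sum_p \sum_q ((Ql.1 *m C *m Ql'.1^T) p q ^+ 2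
                 + (Ql.1 *m B *m Ql'.1^T) p q ^+ 2) / 2 * expR (Ql.2 0 p).
  rewrite (half _ _ (congr1 (fun M => \tr (M *m mexp R n A)) (esym CB))).
  rewrite !(mxtrace_sqr_mexp _ _ _ Ql'.1 AQl)//.
  rewrite !mulr_suml -big_split/=; apply: eq_bigr => p _.
  rewrite !mulr_suml -big_split/=; apply: eq_bigr => q _; ring.
have -> : \tr (B *m B *m mexp R n (A + e *: B)) =
    \sum_p \sum_q ((Ql.1 *m C *m Ql'.1^T) p q ^+ 2
                 + (Ql.1 *m B *m Ql'.1^T) p q ^+ 2) / 2 * expR (Ql'.2 0 q).
  rewrite (half _ _ (congr1 (fun M => \tr (M *m mexp R n (A + e *: B))) (esym CB))).
  rewrite !swap//.
  rewrite !mulr_suml -big_split/=; apply: eq_bigr => p _.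
  rewrite !mulr_suml -big_split/=; apply: eq_bigr => q _; ring.
rewrite -big_split/= mulr_sumr; apply: ler_sum => p _.
rewrite -big_split/= mulr_sumr; apply: ler_sum => q _.
have := eigendec_overlap _ _ _ _ _ _ p q AQl A'Ql'; rewrite addrAC subrr add0r.
rewrite -scalemxAr -scalemxAl mxE.
have := expR_secant_le_trapezoid _ (Ql.2 0 p) (Ql'.2 0 q).
have := expR_gt0 (Ql.2 0 p); have := expR_gt0 (Ql'.2 0 q).
move: (expR (Ql'.2 0 q)) (expR (Ql.2 0 p)) => E' E E'0 E0.
move: (Ql'.2 0 q - Ql.2 0 p) => dl.
move: ((Ql.1 *m C *m _) p q) ((Ql.1 *m B *m _) p q) ((Ql.1 *m _) p q) => S X W.
move=> secant XW.
apply: (le_trans (ler_norm _)); rewrite !normrM.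
apply: (@le_trans _ _ (`|S| * `|W| * (`|dl| * ((E + E') / 2)))).
  by apply: ler_wpM2l => //; rewrite ?mulr_ge0.
have -> : `|S| * `|W| * (`|dl| * ((E + E') / 2)) =
    `|S| * `|W * dl| * ((E + E') / 2) by rewrite normrM; ring.
rewrite -XW normrM (ger0_norm e0).
rewrite -(real_normK (num_real S)) -(real_normK (num_real X)).
move: `|S| `|X| => s x; rewrite -subr_ge0.
rewrite (_ : _ - _ = e / 2 * (E + E') * ((s - x) ^+ 2 / 2)); last by field.
by apply: mulr_ge0; rewrite ?divr_ge0 ?sqr_ge0// mulr_ge0 ?divr_ge0 ?addr_ge0// ltW.
Qed.

Lemma mxtrace_sqr_mexp_ge0 A C : A^T = A -> C^T = C ->
  0 <= \tr (C *m C *m mexp R n A).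
Proof.
move=> /eigendecP AQl Csym.
rewrite (mxtrace_sqr_mexp _ _ _ _ AQl AQl.1 Csym).
by apply: sumr_ge0 => p _; apply: sumr_ge0 => q _; rewrite mulr_ge0 ?sqr_ge0 ?expR_ge0.
Qed.

(** The trapezoidal scheme for [h' <= h] and [f' <= h]: one step of length [d] multiplies [h] by at
    most [r] and raises [f] by at most [(r - 1) * h], so the increments sum geometrically. The bound
    [d < 2] keeps the denominator of [r] positive. *)
Lemma mxtrace_mexp_growth_discrete K B (d : R) (j : nat) :
    K^T = K -> B^T = B -> B *m B *m B = B -> 0 <= d < 2 ->
  let r := (1 + d / 2) / (1 - d / 2) in
  \tr (B *m B *m mexp R n (K + (j%:R * d) *: B)) <=
     r ^+ j * \tr (B *m B *m mexp R n K) /\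
  \tr (B *m mexp R n (K + (j%:R * d) *: B)) - \tr (B *m mexp R n K) <=
     (r ^+ j - 1) * \tr (B *m B *m mexp R n K).
Proof.
move=> Ksym Bsym B3 /andP[d0 d2] r.
have d1 : 0 < 1 - d / 2 by lra.
have r0 : 0 <= r by rewrite divr_ge0//; lra.
have rE : (1 + r) * (d / 2) = r - 1.
  by rewrite /r; field; rewrite subr_eq0 gt_eqF.
elim: j => [|j [IHh IHf]].
  by rewrite mul0r scale0r addr0 expr0 mul1r !subrr mul0r.
have KE : K + (j.+1%:R * d) *: B = K + (j%:R * d) *: B + d *: B.
  by rewrite -addrA -scalerDl mulrSr mulrDl mul1r.
have Kjsym : (K + (j%:R * d) *: B)^T = K + (j%:R * d) *: B.
  by rewrite linearD linearZ /= Ksym Bsym.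
have BBsym : (B *m B)^T = B *m B by rewrite trmx_mul Bsym.
have BB : B *m B *m (B *m B) = B *m B by rewrite mulmxA B3.
move: IHh IHf; rewrite {}KE; move: (K + (j%:R * d) *: B) Kjsym => K1 K1sym.
(* The choice [C = B] controls [f]; the choice [C = B *m B], admissible by the cube identity,
   controls [h]. *)
have := mxtrace_mexp_step _ _ _ _ K1sym Bsym Bsym erefl d0.
have := mxtrace_mexp_step _ _ _ _ K1sym Bsym BBsym BB d0.
have := mxtrace_sqr_mexp_ge0 _ _ K1sym Bsym.
move: (K1 + d *: B) => K2.
rewrite exprSr; set rj := r ^+ j.
move: (\tr (B *m B *m mexp R n K1)) (\tr (B *m B *m mexp R n K2))
  (\tr (B *m B *m mexp R n K)) => h1 h2 h0.
move: (\tr (B *m mexp R n K1)) (\tr (B *m mexp R n K2))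
  (\tr (B *m mexp R n K)) => f1 f2 f0 h10 step_h step_f IHh IHf.
clear Ksym Bsym B3 BBsym BB K1sym.
have h2r : h2 <= r * h1.
  rewrite /r mulrAC ler_pdivlMr//; lra.
have rh : r * h1 <= r * (rj * h0) by rewrite ler_wpM2l.
split; first by rewrite mulrAC mulrC (le_trans h2r)// (le_trans rh)// mulrC mulrAC.
have e1 : d / 2 * (h1 + h2) <= d / 2 * ((1 + r) * h1).
  by rewrite ler_wpM2l ?divr_ge0// mulrDl mul1r lerD2l.
have e2 : d / 2 * ((1 + r) * h1) = (r - 1) * h1 by rewrite -rE; ring.
have r1 : 0 <= r - 1 by rewrite -rE mulr_ge0 ?divr_ge0// addr_ge0.
have e3 : (r - 1) * h1 <= (r - 1) * (rj * h0) by rewrite ler_wpM2l.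
have e4 : (rj * r - 1) * h0 = (rj - 1) * h0 + (r - 1) * (rj * h0) by ring.
by rewrite e4; lra.
Qed.

(* This replaces Lieb's concavity theorem: it bounds the increment of
   [x |-> \tr (B *m mexp (K + x *: B))] as in the scalar case [B = 1]. *)
Lemma mxtrace_mexp_growth K B (z : R) :
    K^T = K -> B^T = B -> B *m B *m B = B -> 0 <= z ->
  \tr (B *m mexp R n (K + z *: B)) - \tr (B *m mexp R n K) <=
  (expR z - 1) * \tr (B *m B *m mexp R n K).
Proof.
move=> Ksym Bsym B3 z0.
have discrete (y : R) : z < y ->
    \tr (B *m mexp R n (K + z *: B)) - \tr (B *m mexp R n K) <=
    (expR y - 1) * \tr (B *m B *m mexp R n K).
  move=> zy; have y0 := le_lt_trans z0 zy.
  (* With [N] steps, [r ^ N <= expR (N * (r - 1))], and [N * (r - 1) <= y] amounts to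
     [N >= y * z / (2 * (y - z))]. The added [z] makes the step shorter than 1. *)
  pose x := y * z / (2 * (y - z)) + z.
  have x0 : 0 <= x by rewrite addr_ge0// divr_ge0 ?mulr_ge0 ?subr_ge0// ltW.
  have := archi_boundP x0; set N := Num.bound x => xN.
  have N0 : 0 < N%:R :> R by exact: le_lt_trans xN.
  have N0' : N%:R != 0 :> R by rewrite gt_eqF.
  have zN : z < N%:R.
    rewrite (le_lt_trans _ xN)// lerDr divr_ge0 ?mulr_ge0 ?subr_ge0// ltW//.
  have d02 : 0 <= z / N%:R < 2.
    apply/andP; split; first by rewrite divr_ge0// ltW.
    by rewrite ltr_pdivrMr// (lt_trans zN)// ltr_pMl// ltr1n.
  have [_] := mxtrace_mexp_growth_discrete _ _ _ N Ksym Bsym B3 d02.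
  rewrite mulrCA divff// mulr1 => /le_trans; apply.
  rewrite ler_wpM2r ?mxtrace_sqr_mexp_ge0// lerB//.
  set r := (1 + _) / _.
  have d1 : 0 < 1 - z / N%:R / 2 by move: d02 => /andP[]; lra.
  have r0 : 0 <= r.
    by apply: divr_ge0; rewrite ?(ltW d1)// addr_ge0// !divr_ge0// ltW.
  rewrite (@le_trans _ _ (expR (r - 1) ^+ N))//.
    by rewrite lerXn2r ?nnegrE ?expR_ge0// (le_trans _ (expR_ge1Dx _))// addrC subrK.
  rewrite -expRM_natl ler_expR.
  have rE : N%:R * (r - 1) * (1 - z / N%:R / 2) = z.
    by rewrite /r; field; rewrite N0' /=; move: d1; lra.
  rewrite -(ler_pM2r d1) rE.
  have : (x - z) * (2 * (y - z)) <= N%:R * (2 * (y - z)).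
    by rewrite ler_wpM2r ?mulr_ge0 ?subr_ge0 ?(ltW zy)//; lra.
  rewrite /x addrK divfK; last by rewrite mulf_neq0 ?subr_eq0 ?gt_eqF.
  move=> yzN; rewrite -subr_ge0.
  rewrite (_ : _ - _ = (N%:R * (2 * (y - z)) - y * z) / (2 * N%:R)); last by field.
  by rewrite divr_ge0 ?subr_ge0// mulr_ge0// ltW.
have h0 := mxtrace_sqr_mexp_ge0 _ _ Ksym Bsym.
move: (_ - _) (\tr (B *m B *m _)) h0 discrete => D h h0 discrete.
clear Ksym Bsym B3.
(* Letting [y] decrease to [z]: a violation would persist at some [y] strictly between [z] and
   [ln (D / h + 1)]; the case [h = 0] is separate. *)
rewrite leNgt; apply/negP => zD.
have {}h0 : 0 < h.
  rewrite lt_def h0 andbT; apply/eqP => h00.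
  have := discrete (z + 1); rewrite ltrDl ltr01 => /(_ isT)/(lt_le_trans zD).
  by rewrite h00 !mulr0 ltxx.
have Dh : expR z < D / h + 1 by rewrite -ltrBlDr ltr_pdivlMr.
have Dh0 : 0 < D / h + 1 by rewrite (lt_trans _ Dh) ?expR_gt0.
have zy : z < ln (D / h + 1) by rewrite -ltr_expR lnK.
have := discrete ((z + ln (D / h + 1)) / 2) ltac:(lra).
have : expR ((z + ln (D / h + 1)) / 2) < expR (ln (D / h + 1)).
  by rewrite ltr_expR; lra.
rewrite lnK// -ltrBlDr ltr_pdivlMr// => /lt_le_trans/[apply].
by rewrite ltxx.
Qed.

End TraceExponential.

Lemma expRB1_le_chord (R : realType) (t U : R) : 0 <= t <= 1 ->
  expR (t * U) - 1 <= t * (expR U - 1).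
Proof.
move=> /andP[t0 t1].
have EU : expR U = expR (t * U) * expR ((1 - t) * U).
  by rewrite -expRD; congr expR; ring.
have E0 : 1 = expR (t * U) * expR (- (t * U)) by rewrite expRxMexpNx_1.
have e0 := expR_ge0 (t * U).
have h1 : expR (t * U) * (1 + (1 - t) * U) <= expR U.
  by rewrite EU ler_wpM2l// expR_ge1Dx.
have h2 : expR (t * U) * (1 - t * U) <= 1.
  by rewrite [leRHS]E0 ler_wpM2l// expR_ge1Dx.
have h3 : t * (expR (t * U) * (1 + (1 - t) * U)) <= t * expR U by rewrite ler_wpM2l.
have h4 : (1 - t) * (expR (t * U) * (1 - t * U)) <= 1 - t.
  by rewrite -[leRHS]mulr1 ler_wpM2l// subr_ge0.
have -> : expR (t * U) = t * (expR (t * U) * (1 + (1 - t) * U)) +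
  (1 - t) * (expR (t * U) * (1 - t * U)) by ring.
lra.
Qed.

(** * Independent Bernoulli multiples of fixed matrices *)

Section TwoPoint.
Variables (R : realType) (n : nat).
Implicit Types (B H : 'M[R]_n).

(* The path from [H - b *: B] to [H + a *: B] is cut at [H + (a - b) *: B], so
   that each end is weighted by the length of the far piece. *)
Lemma mxtrace_mexp_two_point H B (a b : R) :
    H^T = H -> B^T = B -> B *m B *m B = B -> 0 <= a -> 0 <= b ->
  \tr (B *m mexp R n (H + a *: B)) - \tr (B *m mexp R n (H - b *: B)) <=
  (expR a - 1) * \tr (B *m B *m mexp R n (H - b *: B)) +
  (expR b - 1) * \tr (B *m B *m mexp R n (H + a *: B)).
Proof.
move=> Hsym Bsym B3 a0 b0.
have sym (x : R) : (H + x *: B)^T = H + x *: B.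
  by rewrite linearD linearZ /= Hsym Bsym.
have symb : (H - b *: B)^T = H - b *: B by rewrite -scaleNr sym.
have NBsym : (- B)^T = - B by rewrite linearN /= Bsym.
have NB3 : - B *m - B *m - B = - B by rewrite !(mulNmx, mulmxN) !opprK B3.
have := mxtrace_mexp_growth _ _ _ _ _ symb Bsym B3 a0.
have := mxtrace_mexp_growth _ _ _ _ _ (sym a) NBsym NB3 b0.
have -> : H + a *: B + b *: - B = H - b *: B + a *: B.
  by rewrite scalerN addrAC.
rewrite !(mulNmx, mulmxN) !raddfN /= opprK.
move: (H - b *: B + a *: B) => M; rewrite opprK.
move: (\tr (B *m mexp _ _ M)) => f1.
clear; lra.
Qed.

(* A centred variable taking the values [be * (et^-1 - 1)] and [- be] with
   probabilities [et] and [1 - et]. *)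
Lemma bernoulli_mxtrace_mexp_drift H B (th L et be x1 x0 : R) :
    H^T = H -> B^T = B -> B *m B *m B = B ->
    0 <= th -> 0 < L -> 0 < et <= 1 -> 0 <= be -> (et < 1 -> be / et <= L) ->
    x1 = be * (et^-1 - 1) -> x0 = - be ->
  et * (x1 * \tr (B *m mexp R n (H + (th * x1) *: B))) +
  (1 - et) * (x0 * \tr (B *m mexp R n (H + (th * x0) *: B))) <=
  (expR (th * L) - 1) / L * (be ^+ 2 * (et^-1 - 1)) *
  (et * \tr (B *m B *m mexp R n (H + (th * x1) *: B)) +
   (1 - et) * \tr (B *m B *m mexp R n (H + (th * x0) *: B))).
Proof.
move=> Hsym Bsym B3 th0 L0 /andP[et0 et1] be0 beL x1E x0E.
have [etE|etlt1] := eqVneq et 1.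
  by rewrite x1E etE invr1 subrr !mulr0 !mul0r mulr0 addr0.
have {}etlt1 : et < 1 by rewrite lt_neqAle etlt1.
have {}beL := beL etlt1.
have x1_0 : 0 <= x1 by rewrite x1E mulr_ge0// subr_ge0 invf_ge1.
have x1L : x1 <= L by rewrite x1E (le_trans _ beL)// ler_wpM2l// lerBlDr lerDl.
have bex : be <= L by rewrite (le_trans _ beL)// ler_peMr// invf_ge1.
(* By convexity both exponential factors become linear in the jump with the same slope, which is the
   factor [(expR (th * L) - 1) / L] of the conclusion. *)
have chord y : 0 <= y <= L -> expR (th * y) - 1 <= (expR (th * L) - 1) / L * y.
  move=> /andP[y0 yL].
  have -> : th * y = y / L * (th * L) by field; rewrite gt_eqF.
  rewrite [leRHS](_ : _ = y / L * (expR (th * L) - 1)); last by ring.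
  by rewrite expRB1_le_chord// ler_pdivrMr// mul1r yL divr_ge0// ltW.
have := mxtrace_mexp_two_point _ _ (th * x1) (th * be) Hsym Bsym B3
  (mulr_ge0 th0 x1_0) (mulr_ge0 th0 be0).
have -> : H - (th * be) *: B = H + (th * x0) *: B by rewrite x0E mulrN scaleNr.
have sym (x : R) : (H + x *: B)^T = H + x *: B.
  by rewrite linearD linearZ /= Hsym Bsym.
have := mxtrace_sqr_mexp_ge0 _ _ _ _ (sym (th * x1)) Bsym.
have := mxtrace_sqr_mexp_ge0 _ _ _ _ (sym (th * x0)) Bsym.
have := chord x1; rewrite x1_0 x1L => /(_ isT).
have := chord be; rewrite be0 bex => /(_ isT).
move: (\tr (B *m mexp R n (H + (th * x1) *: B))) => f1.
move: (\tr (B *m mexp R n (H + (th * x0) *: B))) => f0.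
move: (\tr (B *m B *m mexp R n (H + (th * x1) *: B))) => h1.
move: (\tr (B *m B *m mexp R n (H + (th * x0) *: B))) => h0.
move: ((expR (th * L) - 1) / L) => ka cb cx h00 h10 f10.
clear Hsym Bsym B3 sym chord.
have w0 : 0 <= be * (1 - et) by rewrite mulr_ge0 ?subr_ge0.
have {}f10 : f1 - f0 <= ka * x1 * h0 + ka * be * h1.
  by rewrite (le_trans f10)// lerD// ler_wpM2r.
(* Centring turns the expectation into a multiple of [f1 - f0]. The crossed lengths [x1 * h0] and
   [be * h1] then recombine into the variance times the expectation of [h]. *)
have -> : et * (x1 * f1) + (1 - et) * (x0 * f0) = be * (1 - et) * (f1 - f0).
  by rewrite x1E x0E; field; rewrite gt_eqF.
rewrite (le_trans (ler_wpM2l w0 f10))//.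
rewrite le_eqVlt; apply/orP; left; apply/eqP.
by rewrite x1E; field; rewrite gt_eqF.
Qed.

End TwoPoint.

Lemma is_derive_fin_sum (R : realType) (I : Type) (r : seq I) (F dF : I -> R -> R)
    (x : R) :
  (forall i, is_derive x 1 (F i) (dF i x)) ->
  is_derive x 1 (fun t => \sum_(i <- r) F i t) (\sum_(i <- r) dF i x).
Proof.
move=> FdF; elim: r => [|i r IHr].
  rewrite big_nil (_ : (fun _ => _) = cst 0); first exact: is_derive_cst.
  by apply/funext => t; rewrite big_nil.
rewrite big_cons (_ : (fun _ => _) = F i + (fun t => \sum_(j <- r) F j t)).
  exact: is_deriveD.
by apply/funext => t; rewrite big_cons.
Qed.

(** * Finite products of Bernoulli laws *)

Section BernoulliProduct.
Variables (R : realType) (I : finType) (et : I -> R).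

Definition bernoulli_weight (g : {ffun I -> bool}) : R :=
  \prod_k (if g k then et k else 1 - et k).

Definition set_bit (g : {ffun I -> bool}) (k : I) (b : bool) : {ffun I -> bool} :=
  [ffun j => if j == k then b else g j].

Lemma set_bit_id g k : set_bit g k (g k) = g.
Proof. by apply/ffunP => j; rewrite ffunE; case: eqP => // ->. Qed.

Lemma set_bitK g k b b' : set_bit (set_bit g k b) k b' = set_bit g k b'.
Proof. by apply/ffunP => j; rewrite !ffunE; case: eqP. Qed.

Lemma set_bitE g k b : set_bit g k b k = b.
Proof. by rewrite ffunE eqxx. Qed.

(** Resampling one bit: by the product form, bit [k] may be averaged first with all others
    frozen. *)
Lemma sum_bernoulli_weight_split (F : {ffun I -> bool} -> R) (k : I) :
  \sum_g bernoulli_weight g * F g =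
  \sum_g bernoulli_weight g * (et k * F (set_bit g k true)
                               + (1 - et k) * F (set_bit g k false)).
Proof.
have halves (G : {ffun I -> bool} -> R) :
    \sum_g G g = \sum_(g : {ffun I -> bool} | g k)
      (G (set_bit g k true) + G (set_bit g k false)).
  rewrite (bigID (fun g : {ffun I -> bool} => g k))/= big_split/=; congr (_ + _).
    by apply: eq_bigr => g gk; rewrite -{1}(set_bit_id g k) gk.
  rewrite (reindex_onto (fun g => set_bit g k false) (fun g => set_bit g k true))/=.
    apply: eq_bigl => g; rewrite set_bitE set_bitK/=.
    apply/eqP/idP => [<-|gk]; first by rewrite set_bitE.
    by rewrite -[RHS](set_bit_id g k) gk.
  by move=> g /negbTE gk; rewrite set_bitK -[RHS](set_bit_id g k) gk.
rewrite halves [RHS]halves; apply: eq_bigr => g _.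
pose w := \prod_(j | j != k) (if g j then et j else 1 - et j).
have wE b : bernoulli_weight (set_bit g k b) = (if b then et k else 1 - et k) * w.
  rewrite /bernoulli_weight (bigD1 k)//= set_bitE; congr (_ * _).
  by apply: eq_bigr => j /negbTE jk; rewrite ffunE jk.
by rewrite !set_bitK !wE; ring.
Qed.

Lemma sum_bernoulli_weight : \sum_g bernoulli_weight g = 1.
Proof.
rewrite -(bigA_distr_bigA (fun k (b : bool) => if b then et k else 1 - et k))/=.
by apply: big1 => k _; rewrite big_bool/= addrC subrK.
Qed.

End BernoulliProduct.

Section OddSymmetry.
Variables (R : realType) (n : nat).
Implicit Types (A V J : 'M[R]_n).

(* Conjugating by [J] replaces [mexp A] by the hyperbolic cosine of [A], which
   dominates the identity; this is where the intrinsic dimension enters. *)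
Lemma mxtrace_mul_mexp_odd A V J (v : R) :
    A^T = A -> J^T = J -> J *m J = 1%:M -> J *m A *m J = - A ->
    J *m V *m J = V ->
    (forall x : 'rV[R]_n, (x *m V *m x^T) 0 0 <= v * (x *m x^T) 0 0) ->
  \tr (V *m mexp R n A) <= \tr V + v * (\tr (mexp R n A) - n%:R).
Proof.
move=> Asym Jsym JJ JAJ JVJ Vv.
have [[Q l] AQl] : exists Ql, is_eigendec R n A Ql.
  by eexists; exact: eigendecP.
have [/= Q1 AE] := AQl.
(* [- A] has two eigendecompositions, one with the flipped basis and the eigenvalues of [A], one
   with the same basis and negated eigenvalues. Comparing them symmetrises [exp] into [cosh] against
   any matrix fixed by the flip. *)
have Jdec : is_eigendec R n (- A) (Q *m J, l).
  split=> /=; rewrite trmx_mul Jsym.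
    by rewrite mulmxA -(mulmxA Q) JJ mulmx1.
  by rewrite -JAJ AE !mulmxA.
have Ndec : is_eigendec R n (- A) (Q, - l).
  by split=> //=; rewrite raddfN/= mulmxN mulNmx -AE.
have trace (W : 'M[R]_n) : J *m W *m J = W -> \tr (W *m mexp R n A) =
    \sum_p (Q *m W *m Q^T) p p * ((expR (l 0 p) + expR (- l 0 p)) / 2).
  move=> JWJ.
  have e1 := mxtrace_mul_mexp _ _ _ W _ AQl.
  have : \tr (W *m mexp R n (- A)) = \tr (W *m mexp R n A).
    rewrite e1 (mxtrace_mul_mexp _ _ _ _ _ Jdec)/=; apply: eq_bigr => p _.
    by rewrite trmx_mul Jsym !mulmxA -(mulmxA Q) -(mulmxA Q) JWJ.
  rewrite (mxtrace_mul_mexp _ _ _ _ _ Ndec)/= => e2.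
  apply: (@mulIf _ 2) => //; rewrite mulr_natr mulr2n {1}e1 -e2 -big_split/=.
  rewrite mulr_suml; apply: eq_bigr => p _; rewrite !mxE.
  by field.
have trV : \tr V = \sum_p (Q *m V *m Q^T) p p.
  by rewrite -[RHS]/(\tr _) mxtrace_mulC mulmxA (mulmx1C Q1) mul1mx.
rewrite -[mexp R n A in leRHS]mul1mx !trace// ?mulmx1//.
have -> : n%:R = \sum_(p < n) 1 :> R by rewrite sumr_const card_ord.
rewrite -sumrB trV mulr_sumr.
rewrite -big_split/=; apply: ler_sum => p _.
rewrite ?mulmx1 Q1 [in X in _ * (X * _ - _)]mxE eqxx mul1r.
set ch := (expR _ + _) / 2.
have ch1 : 0 <= ch - 1.
  rewrite /ch expRN; have := expR_gt0 (l 0 p); move: (expR _) => E E0.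
  rewrite (_ : _ - 1 = (E - 1) ^+ 2 / (2 * E)); last by field; rewrite gt_eqF.
  by rewrite divr_ge0 ?sqr_ge0// mulr_ge0// ltW.
have qVq : (Q *m V *m Q^T) p p <= v.
  have quad (M : 'M[R]_n) :
      (row p Q *m M *m (row p Q)^T) 0 0 = (Q *m M *m Q^T) p p.
    by rewrite -row_mul !mxE; apply: eq_bigr => j _; rewrite !mxE.
  have unit_row : (row p Q *m (row p Q)^T) 0 0 = 1.
    by rewrite -[X in X *m _]mulmx1 quad mulmx1 Q1 mxE eqxx.
  by have := Vv (row p Q); rewrite quad unit_row mulr1.
rewrite -lerBlDl -[X in _ * ch - X]mulr1 -mulrBr.
by rewrite ler_wpM2r.
Qed.

End OddSymmetry.

Section ScaledExponential.
Variables (R : realType) (n : nat) (A : 'M[R]_n) (Ql : 'M[R]_n * 'rV[R]_n).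
Hypothesis AQl : is_eigendec R n A Ql.

(** One eigenbasis serves all [th], which reduces differentiation in [th] to scalars. *)
Lemma is_eigendec_scale (th : R) : is_eigendec R n (th *: A) (Ql.1, th *: Ql.2).
Proof.
case: AQl => Q1 AE; split=> //=.
by rewrite linearZ/= -scalemxAr -scalemxAl -AE.
Qed.

Lemma mxtrace_mexp_scale (th : R) :
  \tr (mexp R n (th *: A)) = \sum_p expR (th * Ql.2 0 p).
Proof.
rewrite -[mexp _ _ _]mul1mx (mxtrace_mul_mexp _ _ _ _ _ (is_eigendec_scale th)).
apply: eq_bigr => p _ /=.
by rewrite mulmx1 AQl.1 !mxE eqxx mul1r.
Qed.

Lemma mxtrace_mul_mexp_scale (th : R) :
  \tr (A *m mexp R n (th *: A)) = \sum_p Ql.2 0 p * expR (th * Ql.2 0 p).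
Proof.
rewrite (mxtrace_mul_mexp _ _ _ _ _ (is_eigendec_scale th)).
apply: eq_bigr => p _ /=; case: AQl => Q1 AE.
rewrite {1}AE !mulmxA Q1 mul1mx -mulmxA Q1 mulmx1.
by rewrite !mxE eqxx mulr1n.
Qed.

End ScaledExponential.

(** * The random matrix series and its exponential moment *)

Section BernoulliSeries.
Variables (R : realType) (I : finType) (n : nat).
Variables (B : I -> 'M[R]_n) (et be : I -> R) (L : R).
Hypotheses (Bsym : forall k, (B k)^T = B k)
  (B3 : forall k, B k *m B k *m B k = B k)
  (et01 : forall k, 0 < et k <= 1) (be0 : forall k, 0 <= be k) (L0 : 0 < L)
  (beL : forall k, et k < 1 -> be k / et k <= L).

Definition bernoulli_series (g : {ffun I -> bool}) : 'M[R]_n :=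
  \sum_k (be k * ((g k)%:R / et k - 1)) *: B k.

(** The expectation of the square of the series: its cross terms vanish by independence and
    centring. *)
Definition bernoulli_variance : 'M[R]_n :=
  \sum_k (be k ^+ 2 * ((et k)^-1 - 1)) *: (B k *m B k).

Let W := bernoulli_weight R I et.
Let Y := bernoulli_series.
Let V := bernoulli_variance.

Lemma bernoulli_weight_ge0 g : 0 <= W g.
Proof.
apply: prodr_ge0 => k _; have /andP[e0 e1] := et01 k.
by case: (g k); rewrite ?subr_ge0// ltW.
Qed.

Lemma bernoulli_series_sym g : (Y g)^T = Y g.
Proof.
by rewrite /Y /bernoulli_series linear_sum/=; apply: eq_bigr => k _;
  rewrite linearZ/= Bsym.
Qed.

Lemma bernoulli_series_drift (th : R) : 0 <= th ->
  \sum_g W g * \tr (Y g *m mexp R n (th *: Y g)) <=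
  (expR (th * L) - 1) / L * \sum_g W g * \tr (V *m mexp R n (th *: Y g)).
Proof.
move=> th0.
have -> : \sum_g W g * \tr (Y g *m mexp R n (th *: Y g)) =
    \sum_k \sum_g W g * (be k * ((g k)%:R / et k - 1)
                           * \tr (B k *m mexp R n (th *: Y g))).
  rewrite exchange_big/=; apply: eq_bigr => g _; rewrite -mulr_sumr.
  congr (_ * _); rewrite {1}/Y /bernoulli_series mulmx_suml linear_sum/=.
  by apply: eq_bigr => k _; rewrite -scalemxAl mxtraceZ.
have -> : \sum_g W g * \tr (V *m mexp R n (th *: Y g)) =
    \sum_k be k ^+ 2 * ((et k)^-1 - 1) *
      \sum_g W g * \tr (B k *m B k *m mexp R n (th *: Y g)).
  under [RHS]eq_bigr do rewrite mulr_sumr.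
  rewrite [RHS]exchange_big/=; apply: eq_bigr => g _.
  rewrite /V /bernoulli_variance mulmx_suml linear_sum/= mulr_sumr.
  by apply: eq_bigr => k _; rewrite -scalemxAl mxtraceZ mulrCA.
rewrite mulr_sumr; apply: ler_sum => k _.
rewrite (sum_bernoulli_weight_split _ _ _ _ k).
rewrite [in leRHS](sum_bernoulli_weight_split _ _ _ _ k).
rewrite [leRHS]mulrA [leRHS]mulr_sumr.
apply: ler_sum => g _; rewrite [leRHS]mulrCA ler_wpM2l ?bernoulli_weight_ge0//.
rewrite !set_bitE.
(* [H] gathers the terms that do not see bit [k]. *)
pose H := th *: \sum_(j | j != k) (be j * ((g j)%:R / et j - 1)) *: B j.
have YE b : th *: Y (set_bit I g k b) = H + (th * (be k * (b%:R / et k - 1))) *: B k.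
  rewrite /Y /bernoulli_series (bigD1 k)//= set_bitE scalerDr scalerA addrC.
  congr (th *: _ + _); apply: eq_bigr => j /negbTE jk.
  by rewrite ffunE jk.
rewrite !YE; apply: bernoulli_mxtrace_mexp_drift => //.
- rewrite /H linearZ/= linear_sum/=; congr (_ *: _).
  by apply: eq_bigr => j _; rewrite linearZ/= Bsym.
- exact: beL.
- by rewrite mul1r.
- by rewrite mul0r sub0r mulrN1.
Qed.

Variables (J : 'M[R]_n) (v : R).
Hypotheses (Jsym : J^T = J) (JJ : J *m J = 1%:M)
  (JBJ : forall k, J *m B k *m J = - B k) (v0 : 0 < v)
  (Vv : forall x : 'rV[R]_n, (x *m V *m x^T) 0 0 <= v * (x *m x^T) 0 0).

Lemma bernoulli_series_odd g : J *m Y g *m J = - Y g.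
Proof.
rewrite /Y /bernoulli_series mulmx_sumr mulmx_suml -sumrN.
by apply: eq_bigr => k _; rewrite -scalemxAr -scalemxAl JBJ scalerN.
Qed.

Lemma bernoulli_variance_even : J *m V *m J = V.
Proof.
rewrite /V /bernoulli_variance mulmx_sumr mulmx_suml.
apply: eq_bigr => k _; rewrite -scalemxAr -scalemxAl; congr (_ *: _).
rewrite -[RHS]opprK -mulmxN -mulNmx -JBJ.
by rewrite !mulmxA -(mulmxA _ J J) JJ mulmx1.
Qed.

(* With [M th] the left-hand side, [bernoulli_series_drift] and
   [mxtrace_mul_mexp_odd] give [M' <= ka * (\tr V + v * M)] where [ka] is the
   derivative of the exponent on the right. *)
Lemma bernoulli_series_mgf (th : R) : 0 <= th ->
  \sum_g W g * (\tr (mexp R n (th *: Y g)) - n%:R) <=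
  \tr V / v * (expR (v * ((expR (th * L) - 1 - th * L) / L ^+ 2)) - 1).
Proof.
move=> th0.
pose l g := (eigendec R n (Y g)).2.
have Ydec g : is_eigendec R n (Y g) (eigendec R n (Y g)).
  exact/eigendecP/bernoulli_series_sym.
pose M (t : R) := \sum_g W g * (\tr (mexp R n (t *: Y g)) - n%:R).
pose dM (t : R) := \sum_g W g * \tr (Y g *m mexp R n (t *: Y g)).
pose G (t : R) := (expR (t * L) - 1 - t * L) / L ^+ 2.
pose ka (t : R) := (expR (t * L) - 1) / L.
have M_derive (t : R) : is_derive t 1 M (dM t).
  apply: (is_derive_fin_sum _ _ _
    (fun g t => W g * (\tr (mexp R n (t *: Y g)) - n%:R))
    (fun g t => W g * \tr (Y g *m mexp R n (t *: Y g)))) => g.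
  pose F p (t : R) := expR (t * l g 0 p).
  have -> : (fun t => W g * (\tr (mexp R n (t *: Y g)) - n%:R)) =
      W g \*: ((fun t => \sum_p F p t) - cst n%:R).
    by apply/funext => u; rewrite (mxtrace_mexp_scale _ _ _ _ (Ydec g)).
  apply: is_deriveZ; rewrite -[\tr _]subr0; apply: is_deriveB.
  rewrite (mxtrace_mul_mexp_scale _ _ _ _ (Ydec g)).
  apply: (is_derive_fin_sum _ _ _ _ (fun p t => l g 0 p * expR (t * l g 0 p))).
  move=> p; rewrite /F; apply: is_derive_eq.
  by rewrite /GRing.scale/=; ring.
have G_derive (t : R) : is_derive t 1 G (ka t).
  rewrite /G /ka; apply: is_derive_eq.
  by rewrite /GRing.scale/=; field; rewrite gt_eqF.
have dM_le t : 0 <= t -> dM t <= ka t * (\tr V + v * M t).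
  move=> t0; apply: (le_trans (bernoulli_series_drift _ t0)).
  rewrite ler_wpM2l//.
    by rewrite divr_ge0 ?(ltW L0)// subr_ge0 -expR0 ler_expR mulr_ge0// ltW.
  have -> : \tr V + v * M t =
      \sum_g W g * (\tr V + v * (\tr (mexp R n (t *: Y g)) - n%:R)).
    have trVE : \tr V = \sum_g W g * \tr V.
      by rewrite -mulr_suml sum_bernoulli_weight mul1r.
    rewrite [X in X + _ = _]trVE /M mulr_sumr -big_split/=.
    by apply: eq_bigr => g _; rewrite [RHS]mulrDr; congr (_ + _); rewrite mulrCA.
  apply: ler_sum => g _; rewrite ler_wpM2l ?bernoulli_weight_ge0//.
  apply: (mxtrace_mul_mexp_odd _ _ _ _ J) => //.
  - by rewrite linearZ/= bernoulli_series_sym.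
  - by rewrite -scalemxAr -scalemxAl bernoulli_series_odd scalerN.
  - exact: bernoulli_variance_even.
(* Integrating factor for [M' <= ka * (\tr V + v * M)]; the sign makes [Phi] nondecreasing. *)
pose Phi (t : R) := - ((\tr V + v * M t) * expR (- (v * G t))).
have : Phi 0 <= Phi th.
  apply: (is_derive_ge0_le _ Phi (fun t =>
    (ka t * v * (\tr V + v * M t) - v * dM t) * expR (- (v * G t)))) th0.
    move=> t; rewrite /Phi; apply: is_derive_eq.
    by rewrite /GRing.scale/=; ring.
  move=> t t0; rewrite mulr_ge0 ?expR_ge0// subr_ge0.
  by rewrite (mulrC (ka t)) -mulrA ler_wpM2l ?dM_le// ltW.
rewrite /Phi lerN2.
have -> : M 0 = 0.
  rewrite /M big1// => g _; rewrite (mxtrace_mexp_scale _ _ _ _ (Ydec g)).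
  under eq_bigr do rewrite mul0r expR0.
  by rewrite sumr_const card_ord subrr mulr0.
have -> : G 0 = 0 by rewrite /G mul0r expR0 subrr subr0 mul0r.
rewrite !mulr0 oppr0 expR0 mulr1 addr0 expRN -/(M th) -/(G th).
rewrite ler_pdivrMr ?expR_gt0//.
move: (expR _) (M th) => E m h.
by rewrite mulrAC ler_pdivlMr//; lra.
Qed.

End BernoulliSeries.

(** * From the exponential moment to the tail *)

(** The usual Bernstein bound on [expR x - 1 - x], multiplied out so that [x >= 3] is included. Two
    differentiations reduce it to [expR (- t) >= 1 - t]. *)
Lemma expR_bernstein (R : realType) (x : R) : 0 <= x ->
  (1 - x / 3) * (expR x - 1 - x) <= x ^+ 2 / 2.
Proof.
move=> x0.
pose f (x : R) := x ^+ 2 / 2 - (1 - x / 3) * (expR x - 1 - x).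
pose df (x : R) := x + (expR x - 1 - x) / 3 - (1 - x / 3) * (expR x - 1).
have df0 (y : R) : 0 <= y -> 0 <= df y.
  move=> y0; have <- : df 0 = 0 by rewrite /df expR0; field.
  apply: (@is_derive_ge0_le _ df (fun t => (1 - expR t * (1 - t)) / 3)) y0.
    move=> t; rewrite /df; apply: is_derive_eq.
    by rewrite /GRing.scale/=; field.
  move=> t t0; rewrite divr_ge0// subr_ge0 -[leRHS](expRxMexpNx_1 t).
  by rewrite ler_wpM2l ?expR_ge0// expR_ge1Dx.
rewrite -subr_ge0 -[leRHS]/(f x).
have <- : f 0 = 0 by rewrite /f expR0; field.
apply: (@is_derive_ge0_le _ f df) x0; last by [].
move=> t; rewrite /f; apply: is_derive_eq.
by rewrite /df /GRing.scale/=; field.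
Qed.

(* The factor 2 absorbs the ratio of [expR a - 1] to [expR (2 * a) - 1 - 2 * a]
   as soon as [2 <= expR a]; otherwise the right-hand side exceeds 1. *)
Lemma bernstein_tail (R : realType) (p tr v L eps : R) :
    0 < v -> v <= tr -> 0 < L -> 0 < eps -> p <= 1 ->
    let th := eps / (v + L * eps / 3) in
    p * (expR (th * eps) - 1 - th * eps) <=
      tr / v * (expR (v * ((expR (th * L) - 1 - th * L) / L ^+ 2)) - 1) ->
  p <= 2 * (tr / v) * expR (- ((eps ^+ 2 / 2) / (v + L * eps / 3))).
Proof.
move=> v0 vtr L0 eps0 p1 th.
have D0 : 0 < v + L * eps / 3 by rewrite addr_gt0// divr_gt0// mulr_gt0.
have th0 : 0 <= th by rewrite divr_ge0// ltW.
pose a := th * eps / 2.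
have aE : eps ^+ 2 / 2 / (v + L * eps / 3) = a.
  by rewrite /a /th; field; move: D0; lra.
have a0 : 0 <= a by rewrite /a divr_ge0// mulr_ge0// ltW.
(* The choice of [th] makes [1 - th * L / 3] equal to [v / (v + L * eps / 3)], so the moment
   exponent is at most [a], while Markov's exponent [th * eps] is [2 * a]. *)
have ga : v * ((expR (th * L) - 1 - th * L) / L ^+ 2) <= a.
  have := expR_bernstein _ _ (mulr_ge0 th0 (ltW L0)).
  have -> : 1 - th * L / 3 = v / (v + L * eps / 3).
    by rewrite /th; field; move: D0; lra.
  move: (expR _ - 1 - _) => psi h.
  rewrite mulrA ler_pdivrMr ?exprn_gt0//.
  move: h; rewrite mulrAC ler_pdivrMr// => /le_trans; apply.
  rewrite le_eqVlt; apply/orP; left; apply/eqP.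
  by rewrite /a /th; field; move: D0; lra.
rewrite aE expRN; set q := tr / v => h.
have q1 : 1 <= q by rewrite ler_pdivlMr// mul1r.
have {ga}h : p * (expR a ^+ 2 - 1 - 2 * a) <= q * (expR a - 1).
  have -> : expR a ^+ 2 = expR (th * eps).
    by rewrite expr2 -expRD; congr expR; rewrite /a; field.
  have -> : 2 * a = th * eps by rewrite /a; field.
  rewrite (le_trans h)// ler_wpM2l ?(le_trans ler01 q1)// lerD2r ler_expR//.
have := expR_ge1Dx a; have := expR_gt0 a; move: (expR a) h => E h E0 Ea.
rewrite ler_pdivlMr//.
have [E2|E2] := leP E 2.
  rewrite (@le_trans _ _ (1 * 2))//; last by lra.
  rewrite (@le_trans _ _ (1 * E))//; first by rewrite ler_wpM2r// ltW.
  by rewrite ler_wpM2l.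
(* From [1 + a <= E] the quantity is at least [(E - 1) ^ 2]; for [E > 2] its double then dominates
   [E * (E - 1)]. *)
have D : 0 < E ^+ 2 - 1 - 2 * a.
  have : 0 < (E - 1) ^+ 2 by rewrite exprn_gt0//; lra.
  by rewrite sqrrB1; lra.
have E3 : E * (E - 1) <= 2 * (E ^+ 2 - 1 - 2 * a).
  have : 0 <= (E - 1) * (E - 2) by rewrite mulr_ge0//; lra.
  rewrite (_ : (E - 1) * (E - 2) = E ^+ 2 - 3 * E + 2); last by ring.
  by rewrite mulrBr -expr2; lra.
rewrite -(ler_pM2r D) (_ : p * E * _ = E * (p * (E ^+ 2 - 1 - 2 * a))); last by ring.
rewrite (le_trans (ler_wpM2l (ltW E0) h))//.
rewrite [leLHS](_ : _ = q * (E * (E - 1))); last by ring.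
rewrite [leRHS](_ : _ = q * (2 * (E ^+ 2 - 1 - 2 * a))); last by ring.
by rewrite ler_wpM2l// (le_trans ler01 q1).
Qed.

(** * Spectral norms and dilations *)

Section VectorNorm.
Variable R : realType.

Lemma vnorm_ge0 (m n : nat) (A : 'M[R]_(m, n)) : 0 <= vnorm A.
Proof. exact: sqrtr_ge0. Qed.

Lemma vnorm_sqr (m n : nat) (A : 'M[R]_(m, n)) :
  vnorm A ^+ 2 = \sum_i \sum_j A i j ^+ 2.
Proof.
by rewrite sqr_sqrtr// sumr_ge0// => i _; rewrite sumr_ge0// => j _; rewrite sqr_ge0.
Qed.

Lemma vnorm_col_sqr (n : nat) (x : 'cV[R]_n) : vnorm x ^+ 2 = (x^T *m x) 0 0.
Proof.
rewrite vnorm_sqr mxE; apply: eq_bigr => i _.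
by rewrite big_ord1 mxE expr2.
Qed.

Lemma vnorm_row_sqr (n : nat) (x : 'rV[R]_n) : vnorm x ^+ 2 = (x *m x^T) 0 0.
Proof.
rewrite vnorm_sqr big_ord1 mxE; apply: eq_bigr => i _.
by rewrite mxE expr2.
Qed.

Lemma vnorm0 (m n : nat) : vnorm (0 : 'M[R]_(m, n)) = 0.
Proof.
rewrite /vnorm big1 ?sqrtr0// => i _; rewrite big1// => j _.
by rewrite mxE expr0n.
Qed.

Lemma le_vnorm (m n : nat) (A : 'M[R]_(m, n)) (r : R) :
  0 <= r -> vnorm A ^+ 2 <= r ^+ 2 -> vnorm A <= r.
Proof. by move=> r0; rewrite ler_sqr ?nnegrE ?vnorm_ge0. Qed.

Lemma unit_ball_image_nonempty (m n : nat) (A : 'M[R]_(m, n)) :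
  [set vnorm (A *m x) | x in [set x : 'cV[R]_n | vnorm x <= 1]] !=set0.
Proof. by exists (vnorm (A *m (0 : 'cV[R]_n))), 0 => //=; rewrite vnorm0. Qed.

Lemma sqr_entry_le_sum (n : nat) (u : 'rV[R]_n) p :
  u 0 p ^+ 2 <= (u *m u^T) 0 0.
Proof.
rewrite mxE (bigD1 p)//= mxE -expr2 lerDl sumr_ge0// => q _.
by rewrite mxE -expr2 sqr_ge0.
Qed.

End VectorNorm.

(** * Norm, eigenvalues and trace of a positive semidefinite matrix *)

Section PsdSpectralNorm.
Variables (R : realType) (n : nat) (V : 'M[R]_n).
Hypotheses (Vsym : V^T = V)
  (Vpsd : forall x : 'rV[R]_n, 0 <= (x *m V *m x^T) 0 0).

Let Q := (eigendec R n V).1.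
Let l := (eigendec R n V).2.

Let Q1 : Q *m Q^T = 1%:M.
Proof. by case: (eigendecP _ _ _ Vsym). Qed.

Let VE : V = Q^T *m diag_mx l *m Q.
Proof. by case: (eigendecP _ _ _ Vsym). Qed.

Let quadE (x : 'rV[R]_n) :
  (x *m V *m x^T) 0 0 = \sum_p l 0 p * (x *m Q^T) 0 p ^+ 2.
Proof.
rewrite {1}VE !mulmxA -(mulmxA _ Q) -{2}(trmxK Q) -trmx_mul mul_mx_diag mxE.
by apply: eq_bigr => p _; rewrite [X in X * _]mxE [X in _ * X]mxE expr2; ring.
Qed.

Let normE (x : 'rV[R]_n) : (x *m x^T) 0 0 = \sum_p (x *m Q^T) 0 p ^+ 2.
Proof.
transitivity ((x *m Q^T *m (x *m Q^T)^T) 0 0).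
  by rewrite trmx_mul trmxK mulmxA -(mulmxA x) (mulmx1C Q1) mulmx1.
by rewrite mxE; apply: eq_bigr => p _; rewrite [X in _ * X]mxE expr2.
Qed.

Let rowQ p : row p Q *m Q^T = delta_mx 0 p.
Proof. by rewrite -row_mul Q1 row1. Qed.

Let eigen_ge0 p : 0 <= l 0 p.
Proof.
have := Vpsd (row p Q); rewrite quadE (bigD1 p)//= rowQ mxE !eqxx expr1n mulr1.
rewrite big1 ?addr0// => q /negbTE qp.
by rewrite mxE qp andbF expr0n mulr0.
Qed.

Let vnorm_mul (x : 'cV[R]_n) :
  vnorm (V *m x) ^+ 2 = \sum_p l 0 p ^+ 2 * (x^T *m Q^T) 0 p ^+ 2.
Proof.
rewrite vnorm_col_sqr trmx_mul Vsym.
transitivity ((x^T *m V *m (x^T *m V)^T) 0 0).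
  by rewrite !trmx_mul trmxK Vsym.
rewrite normE; apply: eq_bigr => p _.
by rewrite VE !mulmxA -(mulmxA _ Q) Q1 mulmx1 mul_mx_diag mxE exprMn mulrC.
Qed.

Let trE : \tr V = \sum_p l 0 p.
Proof. by rewrite VE mxtrace_mulC mulmxA Q1 mul1mx mxtrace_diag. Qed.

(** All eigenvalues are nonnegative, so each is at most the trace. This also bounds the set whose
    supremum is the spectral norm. *)
Let vnorm_mul_le (x : 'cV[R]_n) : vnorm x <= 1 -> vnorm (V *m x) <= \tr V.
Proof.
move=> x1; have tr0 : 0 <= \tr V by rewrite trE sumr_ge0.
apply: le_vnorm => //; rewrite vnorm_mul.
apply: (@le_trans _ _ (\sum_p (\tr V) ^+ 2 * (x^T *m Q^T) 0 p ^+ 2)).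
  apply: ler_sum => p _; rewrite ler_wpM2r ?sqr_ge0// ler_sqr ?nnegrE//.
  by rewrite trE (bigD1 p)//= lerDl sumr_ge0.
rewrite -mulr_sumr -normE trmxK -vnorm_col_sqr ler_piMr ?sqr_ge0//.
by rewrite expr_le1// vnorm_ge0.
Qed.

Lemma spectral_norm_le_mxtrace : spectral_norm V <= \tr V.
Proof.
apply: ge_sup; first exact: unit_ball_image_nonempty.
by move=> _ [x x1 <-]; exact: vnorm_mul_le.
Qed.

Let vnorm_mul_le_spectral_norm (x : 'cV[R]_n) :
  vnorm x <= 1 -> vnorm (V *m x) <= spectral_norm V.
Proof.
move=> x1; apply: ub_le_sup; last by exists x.
by exists (\tr V) => _ [y y1 <-]; exact: vnorm_mul_le.
Qed.

Lemma spectral_norm_ge0 : 0 <= spectral_norm V.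
Proof.
apply: le_trans (vnorm_mul_le_spectral_norm 0 _); first exact: vnorm_ge0.
by rewrite vnorm0.
Qed.

Let eigen_le_spectral_norm p : l 0 p <= spectral_norm V.
Proof.
have unit_sum (a : 'I_n -> R) :
    \sum_q a q * ((delta_mx 0 p : 'rV[R]_n) 0 q) ^+ 2 = a p.
  rewrite (bigD1 p)//= mxE !eqxx expr1n mulr1 big1 ?addr0// => q /negbTE qp.
  by rewrite mxE qp andbF expr0n mulr0.
have -> : l 0 p = vnorm (V *m (row p Q)^T).
  apply/eqP; rewrite -(@eqrXn2 _ 2) ?vnorm_ge0//; apply/eqP.
  by rewrite vnorm_mul trmxK rowQ unit_sum.
apply: vnorm_mul_le_spectral_norm; apply: le_vnorm => //.
rewrite vnorm_col_sqr trmxK normE rowQ.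
by under eq_bigr do rewrite -[_ ^+ 2]mul1r; rewrite (unit_sum (fun=> 1)) expr1n.
Qed.

Lemma quad_le_spectral_norm (x : 'rV[R]_n) :
  (x *m V *m x^T) 0 0 <= spectral_norm V * (x *m x^T) 0 0.
Proof.
rewrite quadE normE mulr_sumr; apply: ler_sum => p _.
by rewrite ler_wpM2r ?sqr_ge0.
Qed.

Lemma spectral_norm_eq0_mxtrace : spectral_norm V = 0 -> \tr V = 0.
Proof.
move=> V0; apply/le_anti; rewrite trE sumr_ge0// andbT.
by rewrite -[leRHS](@big1 R 0 +%R 'I_n (index_enum _) xpredT (fun=> 0))//
   ler_sum// => p _; rewrite -V0.
Qed.

End PsdSpectralNorm.

Section Jensen.
Variables (R : realType) (n : nat).
Implicit Types A : 'M[R]_n.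

(** The left-hand side is the tangent at [c] of the convex function [expR t - 1 - t]. *)
Lemma expR_tangent (c t : R) :
  (expR c - 1) * t + (expR c - 1 - c * expR c) <= expR t - 1 - t.
Proof.
have : expR c * (1 + (t - c)) <= expR t.
  rewrite (_ : expR t = expR c * expR (t - c)); last first.
    by rewrite -expRD; congr expR; ring.
  by rewrite ler_wpM2l ?expR_ge0// expR_ge1Dx.
rewrite -subr_ge0 => h; rewrite -subr_ge0.
by rewrite (_ : _ - _ = expR t - expR c * (1 + (t - c)))//; ring.
Qed.

(* Jensen's inequality for [expR t - 1 - t] and the (sub-probability) spectral
   weights of [A] at [w]. *)
Lemma mxtrace_mexp_ge_quad A (w : 'rV[R]_n) (c : R) :
    A^T = A -> \tr A = 0 -> (w *m w^T) 0 0 <= 1 -> 0 <= c ->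
    c <= (w *m A *m w^T) 0 0 ->
  expR c - 1 - c <= \tr (mexp R n A) - n%:R.
Proof.
move=> Asym trA w1 c0 cA.
have Adec := eigendecP _ _ _ Asym; have [Q1 AE] := Adec.
set Q := (eigendec R n A).1 in Q1 AE; set l := (eigendec R n A).2 in AE.
have trE : \sum_p l 0 p = 0.
  by rewrite -mxtrace_diag -[diag_mx l]mul1mx -Q1 -mulmxA mxtrace_mulC -AE.
have := mxtrace_mexp_scale _ _ _ _ Adec 1; rewrite scale1r => ->.
have -> : n%:R = \sum_(p < n) 1 :> R by rewrite sumr_const card_ord.
rewrite -sumrB; pose u := w *m Q^T.
have uu : (u *m u^T) 0 0 <= 1.
  by rewrite /u trmx_mul trmxK mulmxA -(mulmxA w) (mulmx1C Q1) mulmx1.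
have uE : (u *m u^T) 0 0 = \sum_p u 0 p ^+ 2.
  by rewrite mxE; apply: eq_bigr => p _; rewrite [X in _ * X]mxE expr2.
have psi0 (t : R) : 0 <= expR t - 1 - t.
  by rewrite -addrA -opprD subr_ge0 expR_ge1Dx.
have quad : (w *m A *m w^T) 0 0 = \sum_p u 0 p ^+ 2 * l 0 p.
  rewrite {1}AE !mulmxA -/u -(mulmxA _ Q) -{1}(trmxK Q) -trmx_mul -/u mul_mx_diag mxE.
  by apply: eq_bigr => p _; rewrite [X in X * _]mxE [X in _ * X]mxE -/u expr2; ring.
have -> : \sum_(p < n) (expR (1 * l 0 p) - 1) = \sum_p (expR (l 0 p) - 1 - l 0 p).
  by rewrite [RHS]sumrB trE subr0; apply: eq_bigr => p _; rewrite mul1r.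
apply: (@le_trans _ _ (\sum_p u 0 p ^+ 2 * (expR (l 0 p) - 1 - l 0 p))); last first.
  apply: ler_sum => p _; rewrite ler_piMl//.
  exact: le_trans (sqr_entry_le_sum _ _ _ _) uu.
apply: (@le_trans _ _ (\sum_p u 0 p ^+ 2 *
    ((expR c - 1) * l 0 p + (expR c - 1 - c * expR c)))); last first.
  by apply: ler_sum => p _; rewrite ler_wpM2l ?sqr_ge0// expR_tangent.
under eq_bigr do rewrite mulrDr mulrCA.
rewrite big_split/= -mulr_sumr -quad -mulr_suml -uE.
(* The tangent has a nonpositive intercept, so a total weight below 1 only helps. *)
have K0 : 0 <= - (expR c - 1 - c * expR c).
  have := expR_tangent c 0; rewrite expR0 mulr0 add0r subrr subr0.
  by rewrite -oppr_ge0.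
have h1 : (expR c - 1) * c <= (expR c - 1) * (w *m A *m w^T) 0 0.
  by rewrite ler_wpM2l// subr_ge0 -expR0 ler_expR.
have h2 : (u *m u^T) 0 0 * - (expR c - 1 - c * expR c) <= - (expR c - 1 - c * expR c).
  by rewrite ler_piMl.
move: h1 h2; move: ((w *m _ *m _) 0 0) ((u *m _) 0 0) => a b.
rewrite mulrN lerN2 => h1 h2; apply: (le_trans _ (lerD h1 h2)).
by rewrite le_eqVlt; apply/orP; left; apply/eqP; ring.
Qed.

Lemma mxtrace_mexp_ge A : A^T = A -> \tr A = 0 -> n%:R <= \tr (mexp R n A).
Proof.
move=> Asym trA; rewrite -subr_ge0.
have := mxtrace_mexp_ge_quad A 0 0 Asym trA.
rewrite expR0 subrr subr0 !mul0mx mxE; exact.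
Qed.

End Jensen.

(** * Hermitian dilations *)

Section Dilation.
Variables (R : realType) (s m : nat).
Implicit Types (D : 'M[R]_(s, m)) (u : 'rV[R]_s) (v : 'rV[R]_m).

Definition dilation D : 'M[R]_(s + m) := block_mx 0 D D^T 0.

Definition dilation_flip : 'M[R]_(s + m) := block_mx 1%:M 0 0 (- 1%:M).

Lemma dilation_sym D : (dilation D)^T = dilation D.
Proof. by rewrite /dilation tr_block_mx !trmx0 trmxK. Qed.

Lemma mxtrace_dilation D : \tr (dilation D) = 0.
Proof. by rewrite mxtrace_block !raddf0 addr0. Qed.

Lemma dilationZ (a : R) D : dilation (a *: D) = a *: dilation D.
Proof. by rewrite /dilation scale_block_mx !scaler0 linearZ. Qed.

Lemma dilation_sum (I : Type) (r : seq I) (F : I -> 'M[R]_(s, m)) :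
  dilation (\sum_(i <- r) F i) = \sum_(i <- r) dilation (F i).
Proof.
elim: r => [|i r IHr].
  by rewrite !big_nil /dilation trmx0 block_mx_const.
by rewrite !big_cons -IHr /dilation add_block_mx !addr0 linearD.
Qed.

Lemma dilation_flip_sym : dilation_flip^T = dilation_flip.
Proof. by rewrite /dilation_flip tr_block_mx !trmx0 linearN /= !trmx1. Qed.

Lemma dilation_flip_sqr : dilation_flip *m dilation_flip = 1%:M.
Proof.
rewrite /dilation_flip mulmx_block !mulmx0 !mul0mx !addr0 add0r mulmx1.
by rewrite mulNmx mulmxN opprK mulmx1 -scalar_mx_block.
Qed.

Lemma dilation_flip_conj D :
  dilation_flip *m dilation D *m dilation_flip = - dilation D.
Proof.
rewrite /dilation_flip /dilation !mulmx_block !(mulmx0, mul0mx, addr0, add0r).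
by rewrite mul1mx !mulNmx mulmxN !mulmx1 mul1mx opp_block_mx !oppr0.
Qed.

Lemma dilation_outer_sqr u v :
  dilation (u^T *m v) *m dilation (u^T *m v) =
  block_mx ((v *m v^T) 0 0 *: (u^T *m u)) 0 0 ((u *m u^T) 0 0 *: (v^T *m v)).
Proof.
rewrite /dilation mulmx_block !(mulmx0, mul0mx, addr0, add0r) trmx_mul trmxK.
congr block_mx; rewrite !mulmxA.
  rewrite -(mulmxA _ v) [v *m v^T]mx11_scalar mul_mx_scalar -scalemxAl.
  by rewrite -mx11_scalar.
rewrite -(mulmxA _ u) [u *m u^T]mx11_scalar mul_mx_scalar -scalemxAl.
by rewrite -mx11_scalar.
Qed.

Lemma dilation_outer_cube u v :
  dilation (u^T *m v) *m dilation (u^T *m v) *m dilation (u^T *m v) =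
  ((u *m u^T) 0 0 * (v *m v^T) 0 0) *: dilation (u^T *m v).
Proof.
rewrite dilation_outer_sqr /dilation mulmx_block !(mulmx0, mul0mx, addr0, add0r).
rewrite scale_block_mx !scaler0 trmx_mul trmxK; congr block_mx.
  rewrite -scalemxAl !mulmxA -(mulmxA _ u) [u *m u^T]mx11_scalar mul_mx_scalar.
  by rewrite -scalemxAl scalerA -mx11_scalar mulrC.
rewrite -scalemxAl !mulmxA -(mulmxA _ v) [v *m v^T]mx11_scalar mul_mx_scalar.
by rewrite -scalemxAl scalerA -mx11_scalar.
Qed.

(** For [y = D *m x], the quadratic form of the dilation at [(y / |y|, x) / sqrt 2] is [|y|]. The
    supremum is only approached, so the bound is proved for each [e < eps] and passed to the
    limit. *)
Lemma mxtrace_mexp_dilation_ge D (eps th : R) :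
    0 < eps -> eps <= spectral_norm D -> 0 <= th ->
  expR (th * eps) - 1 - th * eps <=
  \tr (mexp R (s + m) (th *: dilation D)) - (s + m)%:R.
Proof.
move=> eps0 epsD th0; set X := \tr _ - _.
have Asym : (th *: dilation D)^T = th *: dilation D.
  by rewrite linearZ/= dilation_sym.
have Atr : \tr (th *: dilation D) = 0 by rewrite mxtraceZ mxtrace_dilation mulr0.
have near_norm (e : R) : 0 <= e -> e < eps -> expR (th * e) - 1 - th * e <= X.
  move=> e0 e_eps.
  have [_ [x /= x1 <-] ey] := sup_gt (unit_ball_image_nonempty _ _ _ D)
    (lt_le_trans e_eps epsD).
  set y := D *m x in ey; have y0 : 0 < vnorm y := le_lt_trans e0 ey.
  pose k : R := Num.sqrt (2^-1).
  have kk : k * k = 2^-1 by rewrite -expr2 sqr_sqrtr// invr_ge0.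
  pose a := (vnorm y)^-1 *: y^T.
  have ya : a *m y = (vnorm y)%:M.
    rewrite /a -scalemxAl [y^T *m y]mx11_scalar -vnorm_col_sqr.
    by rewrite scale_scalar_mx expr2 mulKf// gt_eqF.
  have aa : a *m a^T = 1%:M.
    by rewrite {2}/a linearZ/= trmxK -scalemxAr ya scale_scalar_mx mulVf// gt_eqF.
  pose w := k *: row_mx a x^T.
  have wT : w^T = k *: col_mx a^T x by rewrite /w linearZ/= tr_row_mx trmxK.
  apply: (mxtrace_mexp_ge_quad _ _ _ w) => //; last 2 first.
  - by rewrite mulr_ge0.
  - rewrite wT /w -!scalemxAl -!scalemxAr -!scalemxAl.
    rewrite /dilation mul_row_block !(mulmx0, addr0, add0r) mul_row_col.
    have -> : x^T *m D^T *m a^T = (vnorm y)%:M.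
      by rewrite -trmx_mul -/y -trmx_mul ya tr_scalar_mx.
    rewrite -(mulmxA a) -/y ya !mxE eqxx mulr1n.
    rewrite [leRHS](_ : _ = k * k * (th * (vnorm y + vnorm y))); last by ring.
    rewrite kk [leRHS](_ : _ = th * vnorm y); last by field.
    by rewrite ler_wpM2l// ltW.
  - rewrite wT /w -scalemxAl -scalemxAr scalerA kk.
    rewrite mul_row_col aa [x^T *m x]mx11_scalar -vnorm_col_sqr !mxE eqxx !mulr1n.
    have : vnorm x ^+ 2 <= 1 by rewrite expr_le1// vnorm_ge0.
    by move=> x2; rewrite mulrDr mulr1; lra.
rewrite leNgt; apply/negP => gap.
have E0 := expR_gt0 (th * eps).
pose c := th * eps; pose g := expR c - 1 - c - X.
have g0 : 0 < g by rewrite subr_gt0.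
(* By the tangent at [c], retreating by [de] loses at most [th * de * expR c], here at most half the
   supposed gap. Using [th + 1] covers [th = 0]. *)
pose de := Num.min eps (g / (2 * (th + 1) * expR c)).
have den0 : 0 < 2 * (th + 1) * expR c by rewrite !mulr_gt0// ltr_wpDl.
have de0 : 0 < de by rewrite lt_min eps0 divr_gt0.
have := near_norm (eps - de); rewrite subr_ge0 ge_min lexx ltrBlDr ltrDl.
move=> /(_ isT de0) h.
have := expR_tangent R c (th * (eps - de)).
rewrite mulrBr -/c => tan; move: h; rewrite mulrBr -/c => h.
have deg : th * de * expR c <= g / 2.
  have : de <= g / (2 * (th + 1) * expR c) by rewrite ge_min lexx orbT.
  rewrite ler_pdivlMr// => deg.
  have : th * de * expR c <= (th + 1) * de * expR c.
    by rewrite !ler_wpM2r ?expR_ge0 ?(ltW de0)// lerDl.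
  move: deg; rewrite [de * _](_ : _ = 2 * ((th + 1) * de * expR c)); last by ring.
  lra.
have thde : 0 <= th * de by rewrite mulr_ge0// ltW.
have := le_trans tan h.
rewrite [leLHS](_ : _ = expR c - 1 - c - th * de * expR c + th * de); last by ring.
move: g0 deg thde; rewrite /g; lra.
Qed.

End Dilation.

(** * The sketched product *)

Section BernoulliEvents.
Variables (R : realType) (d : measure_display) (T : measurableType d)
  (Pr : probability T R) (I : finType) (X : I -> {RV Pr >-> bool}) (et : I -> R).
Hypotheses (et01 : forall i, 0 <= et i <= 1)
  (Xdist : forall i, distribution Pr (X i) =1 bernoulli_prob (et i))
  (Xindep : mutually_independent X).

Let pattern (w : T) : {ffun I -> bool} := [ffun i => X i w].

Let pattern_set (g : {ffun I -> bool}) : [set w | pattern w = g] =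
  \bigcap_(i in [set` [set: I]%SET]) (X i @^-1` [set g i]).
Proof.
apply/seteqP; split => w /=; first by move=> <- i _; rewrite /= ffunE.
by move=> h; apply/ffunP => i; rewrite ffunE; apply: h; rewrite /= inE.
Qed.

Let measurable_pattern g : measurable [set w | pattern w = g].
Proof.
rewrite pattern_set; apply: fin_bigcap_measurable => // i _.
exact: measurable_funPTI.
Qed.

Let pr_pattern g : Pr [set w | pattern w = g] = (bernoulli_weight R I et g)%:E.
Proof.
rewrite pattern_set (Xindep _ (fun i => [set g i]))// /bernoulli_weight -prodEFin.
apply: eq_big => [i|i _]; first by rewrite inE.
rewrite -[LHS]/(distribution Pr (X i) [set g i]) Xdist bernoulli_probE//.
rewrite !diracE; case: (g i).
  by rewrite mem_set// memNset//= mule1 mule0 adde0.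
by rewrite memNset// mem_set//= mule1 mule0 add0e.
Qed.

(** An event determined by the bits is a finite union of pattern events. Subadditivity suffices for
    an upper bound, and the induction carries measurability along. *)
Lemma pr_bernoulli_event_le (Q : pred {ffun I -> bool}) :
  (Pr [set w | Q [ffun i => X i w]] <=
   (\sum_(g | Q g) bernoulli_weight R I et g)%:E)%E.
Proof.
have partial (r : seq {ffun I -> bool}) :
    measurable [set w | Q (pattern w) && (pattern w \in r)] /\
    (Pr [set w | Q (pattern w) && (pattern w \in r)] <=
     (\sum_(g <- r | Q g) bernoulli_weight R I et g)%:E)%E.
  elim: r => [|g r [mr IHr]].
    rewrite big_nil (_ : [set w | _] = set0) ?measure0//.
    by apply/seteqP; split => w //=; rewrite andbF.
  rewrite big_cons; case: (boolP (Q g)) => Qg; last first.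
    rewrite (_ : [set w | _] = [set w | Q (pattern w) && (pattern w \in r)])//.
    apply/seteqP; split => w /=; rewrite inE; last by case/andP => -> ->; rewrite orbT.
    by case/andP => Qw /orP[/eqP wg|->]; [rewrite -wg Qw in Qg|rewrite Qw].
  have -> : [set w | Q (pattern w) && (pattern w \in g :: r)] =
      [set w | pattern w = g] `|` [set w | Q (pattern w) && (pattern w \in r)].
    apply/seteqP; split => w /=; rewrite inE.
      by case/andP => Qw /orP[/eqP|wr]; [left|right; rewrite Qw].
    by case=> [->|/andP[-> ->]]; rewrite ?eqxx ?Qg ?orbT.
  split; first exact: measurableU.
  apply: (le_trans (measureU2 _ _ _)) => //.
  by rewrite EFinD leeD// -pr_pattern.
have [_] := partial (index_enum _).
rewrite (_ : [set w | _] = [set w | Q [ffun i => X i w]])//.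
by apply/seteqP; split => w /=; rewrite mem_index_enum andbT.
Qed.

End BernoulliEvents.

Lemma mulmx_diag_sum (R : comRingType) (N s m : nat) (A : 'M[R]_(N, s))
    (d : 'rV[R]_N) (B : 'M[R]_(N, m)) :
  A^T *m diag_mx d *m B = \sum_i d 0 i *: ((row i A)^T *m row i B).
Proof.
apply/matrixP => j k; rewrite mul_mx_diag summxE mxE; apply: eq_bigr => i _.
by rewrite !mxE big_ord1 !mxE mulrCA mulrA mulrC mulrA.
Qed.

Section SketchedProduct.
Variables (R : realType) (N s m : nat) (P : 'M[R]_N) (U : 'M[R]_(N, s))
  (Ud : 'M[R]_(N, m)) (c nu : nat).
Hypotheses (P_diag : is_diag_mx P) (P_gt0 : forall i, 0 < P i i)
  (c_gt0 : (0 < c)%N) (nu_gt0 : (0 < nu)%N)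
  (eta_gt0 : forall i, 0 < eta U Ud c i).

Let nu0 : 0 < nu%:R :> R. Proof. by rewrite ltr0n. Qed.
Let c0 : 0 < c%:R :> R. Proof. by rewrite ltr0n. Qed.

Let lev_sum := \sum_(j < N) leverage U j * leverage Ud j.

Let rU i := vnorm (row i U).
Let rUd i := vnorm (row i Ud).

Let leverage_ge0 k (A : 'M[R]_(N, k)) i : 0 <= leverage A i.
Proof. exact: sqr_ge0. Qed.

Let lev_sum_ge0 : 0 <= lev_sum.
Proof. by rewrite sumr_ge0// => j _; rewrite mulr_ge0. Qed.

Let Lfactor_ge0 : 0 <= (nu%:R * c%:R)^-1 * lev_sum.
Proof. by rewrite mulr_ge0// invr_ge0 mulr_ge0// ler0n. Qed.

Let zeta_gt0 i : 0 < zeta U Ud i.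
Proof.
by have := eta_gt0 i; rewrite lt_min ltr01/= pmulr_rgt0.
Qed.

Let lev_sum_gt0 (i : 'I_N) : 0 < lev_sum.
Proof.
rewrite lt_def lev_sum_ge0 andbT; apply/eqP => s0.
(* Division by zero yields 0, so a vanishing sum would contradict the positivity of [zeta]. *)
by have := zeta_gt0 i; rewrite /zeta -/lev_sum s0 invr0 mulr0 ltxx.
Qed.

Let lev_gt0 i : 0 < leverage U i * leverage Ud i.
Proof.
have := zeta_gt0 i; rewrite /zeta -/lev_sum.
by rewrite pmulr_lgt0 ?invr_gt0 ?lev_sum_gt0.
Qed.

Let rr_gt0 i : 0 < rU i * rUd i.
Proof.
rewrite lt_def mulr_ge0 ?vnorm_ge0// andbT.
have := lev_gt0 i; rewrite /leverage -exprMn => h.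
by apply/eqP => r0; move: h; rewrite /rU /rUd in r0; rewrite r0 expr0n ltxx.
Qed.

Let sqrt_lev i : Num.sqrt (leverage U i * leverage Ud i) = rU i * rUd i.
Proof. by rewrite /leverage -exprMn sqrtr_sqr ger0_norm//; exact/ltW/rr_gt0. Qed.

Let eta01 i : 0 < eta U Ud c i <= 1.
Proof. by rewrite eta_gt0/= ge_min lexx. Qed.

(** Normalised so that the nonzero eigenvalues are 1 and -1; the length removed here reappears in
    [sketch_scale]. *)
Definition sketch_dir (k : 'I_nu * 'I_N) : 'M[R]_(s + m) :=
  (rU k.2 * rUd k.2)^-1 *: dilation R s m ((row k.2 U)^T *m row k.2 Ud).

Definition sketch_scale (k : 'I_nu * 'I_N) : R :=
  P k.2 k.2 * (rU k.2 * rUd k.2) / nu%:R.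

Definition sketch_prob (k : 'I_nu * 'I_N) : R := eta U Ud c k.2.

Lemma sketch_dir_sym k : (sketch_dir k)^T = sketch_dir k.
Proof. by rewrite linearZ/= dilation_sym. Qed.

Lemma sketch_dir_cube k :
  sketch_dir k *m sketch_dir k *m sketch_dir k = sketch_dir k.
Proof.
rewrite /sketch_dir -!scalemxAl -!scalemxAr -!scalemxAl !scalerA.
rewrite dilation_outer_cube -!vnorm_row_sqr scalerA; congr (_ *: _).
rewrite -/(rU _) -/(rUd _) -exprMn; have := rr_gt0 k.2.
by move: (_ * _) => r r0; field; rewrite gt_eqF.
Qed.

Lemma sketch_dir_odd k :
  dilation_flip R s m *m sketch_dir k *m dilation_flip R s m = - sketch_dir k.
Proof. by rewrite -scalemxAr -scalemxAl dilation_flip_conj scalerN. Qed.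

Lemma sketch_scale_ge0 k : 0 <= sketch_scale k.
Proof. by rewrite divr_ge0 ?ltW// mulr_gt0. Qed.

(** This is the origin of [Lconst]: below 1 the probability is exactly [c * zeta], whose numerator
    cancels one factor of the row norms. *)
Lemma sketch_scale_le_Lconst k : sketch_prob k < 1 ->
  sketch_scale k / sketch_prob k <= Lconst P U Ud c nu.
Proof.
case: k => t i; rewrite /sketch_prob /sketch_scale /= /eta => eta1.
have {}eta1 : c%:R * zeta U Ud i < 1 by move: eta1; rewrite gt_min ltxx.
rewrite (min_idPr (ltW eta1)) /zeta -/lev_sum.
have -> : leverage U i * leverage Ud i = (rU i * rUd i) ^+ 2.
  by rewrite /leverage -exprMn.
have S0 := lev_sum_gt0 i; have r0 := rr_gt0 i.
rewrite (_ : _ / _ = (nu%:R * c%:R)^-1 * lev_sum * (P i i / (rU i * rUd i))).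
  rewrite /Lconst -/lev_sum ler_wpM2l ?Lfactor_ge0//.
  rewrite -sqrt_lev.
  exact: (le_bigmax _
    (fun j => P j j / Num.sqrt (leverage U j * leverage Ud j)) i).
move: (rU i * rUd i) r0 => r r0.
by field; rewrite !gt_eqF.
Qed.

Lemma Lconst_ge0 : 0 <= Lconst P U Ud c nu.
Proof.
by rewrite mulr_ge0 ?Lfactor_ge0// bigmax_ge_id.
Qed.

Lemma Lconst_gt0 (i : 'I_N) : 0 < Lconst P U Ud c nu.
Proof.
rewrite !mulr_gt0 ?invr_gt0 ?mulr_gt0// ?lev_sum_gt0//.
apply: (@lt_le_trans _ _ (P i i / Num.sqrt (leverage U i * leverage Ud i))).
  by rewrite divr_gt0// sqrtr_gt0.
exact: (le_bigmax _ (fun j => P j j / Num.sqrt (leverage U j * leverage Ud j)) i).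
Qed.

Let sum_pair (F : 'I_nu * 'I_N -> 'M[R]_(s + m)) :
  \sum_k F k = \sum_t \sum_i F (t, i).
Proof. by rewrite pair_bigA; apply: eq_bigr => -[]. Qed.

Lemma dilation_sketch_error (g : {ffun 'I_nu * 'I_N -> bool}) :
  dilation R s m (Zbar P U Ud c (fun t i => g (t, i)) - Zmx P U Ud) =
  bernoulli_series R _ _ sketch_dir sketch_prob sketch_scale g.
Proof.
have PE : P = diag_mx (\row_i P i i).
  apply/matrixP => i j; rewrite !mxE; case: eqVneq => [->|ij]; first by rewrite mulr1n.
  by rewrite mulr0n; move/is_diag_mxP: P_diag; apply.
have ZE : Zmx P U Ud = \sum_i P i i *: ((row i U)^T *m row i Ud).
  rewrite /Zmx {1}PE mulmx_diag_sum; apply: eq_bigr => i _.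
  by rewrite mxE.
have ZbarE : Zbar P U Ud c (fun t i => g (t, i)) = nu%:R^-1 *: \sum_t \sum_i
    (P i i * ((g (t, i))%:R / eta U Ud c i)) *: ((row i U)^T *m row i Ud).
  rewrite /Zbar; congr (_ *: _); apply: eq_bigr => t _.
  rewrite /sketch /diag_sqrt tr_diag_mx -!(mulmxA U^T) !mulmx_diag.
  rewrite mulmxA mulmx_diag_sum.
  apply: eq_bigr => i _; congr (_ *: _); rewrite !mxE.
  (* A bit equals its square, so the two sketches combine into one factor [b / e]. *)
  have core (p e : R) (b : bool) : 0 < p -> 0 < e ->
      Num.sqrt p * (b%:R / Num.sqrt e) * (b%:R / Num.sqrt e) * Num.sqrt p =
      p * (b%:R / e).
    move=> p0 e0; rewrite -[X in _ = X * _](sqr_sqrtr (ltW p0)).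
    rewrite -[X in _ = _ * (_ / X)](sqr_sqrtr (ltW e0)).
    have : Num.sqrt e != 0 by rewrite gt_eqF// sqrtr_gt0.
    have : b%:R * b%:R = b%:R :> R by case: b; rewrite ?mulr1 ?mulr0.
    move: b%:R (Num.sqrt p) (Num.sqrt e) => z x y zz y0.
    by rewrite -[in RHS]zz; field.
  by rewrite -core// !mulrA.
rewrite ZbarE ZE.
have -> : \sum_i P i i *: ((row i U)^T *m row i Ud) =
    nu%:R^-1 *: \sum_(t < nu) \sum_i P i i *: ((row i U)^T *m row i Ud).
  rewrite sumr_const card_ord -[X in _ *: X]scaler_nat scalerA mulVf ?scale1r//.
  by rewrite gt_eqF.
rewrite -scalerBr dilationZ -sumrB dilation_sum scaler_sumr.
rewrite /bernoulli_series sum_pair.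
apply: eq_bigr => t _; rewrite -sumrB dilation_sum scaler_sumr.
apply: eq_bigr => i _.
rewrite -scalerBl dilationZ /sketch_dir /sketch_scale /sketch_prob /= !scalerA.
congr (_ *: _); have := rr_gt0 i; move: (_ * rUd i) => r r0.
by field; rewrite !gt_eqF.
Qed.

Lemma sketch_variance :
  bernoulli_variance R _ _ sketch_dir sketch_prob sketch_scale = Vmx P U Ud c nu.
Proof.
rewrite /bernoulli_variance /Vmx.
rewrite sum_pair.
have block_sum (I : Type) (r : seq I) (F : I -> 'M[R]_s) (G : I -> 'M[R]_m) :
    block_mx (\sum_(i <- r) F i) 0 0 (\sum_(i <- r) G i) =
    \sum_(i <- r) block_mx (F i) 0 0 (G i).
  elim: r => [|i r IHr]; first by rewrite !big_nil block_mx_const.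
  by rewrite !big_cons -IHr add_block_mx !addr0.
rewrite block_sum /sketch_scale /sketch_prob /sketch_dir /=.
(* The [nu] rounds contribute equally, each with [nu ^ -2], leaving the factor [1 / nu]. *)
rewrite sumr_const card_ord -[LHS]scaler_nat !scaler_sumr; apply: eq_bigr => i _.
rewrite -scalemxAl -scalemxAr dilation_outer_sqr -!vnorm_row_sqr.
rewrite -/(leverage U i) -/(leverage Ud i).
rewrite -[X in _ = _ *: block_mx X _ _ _]scalerA.
rewrite -[X in _ = _ *: block_mx _ _ _ X]scalerA.
set Mi := block_mx _ _ _ _.
rewrite [X in _ = _ *: X](_ : _ = (P i i ^+ 2 * ((eta U Ud c i)^-1 - 1)) *: Mi).
  rewrite !scalerA; congr (_ *: _).
  have := rr_gt0 i; have := eta_gt0 i.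
  move: (rU i * rUd i) (eta _ _ _ _) => r e e0 r0.
  by field; rewrite !gt_eqF.
by rewrite /Mi scale_block_mx !scaler0.
Qed.

Lemma Vmx_sym : (Vmx P U Ud c nu)^T = Vmx P U Ud c nu.
Proof.
rewrite -sketch_variance /bernoulli_variance linear_sum/=; apply: eq_bigr => k _.
by rewrite linearZ/= trmx_mul sketch_dir_sym.
Qed.

Lemma Vmx_psd (x : 'rV[R]_(s + m)) : 0 <= (x *m Vmx P U Ud c nu *m x^T) 0 0.
Proof.
rewrite -sketch_variance /bernoulli_variance mulmx_sumr mulmx_suml summxE.
apply: sumr_ge0 => k _; rewrite -scalemxAr -scalemxAl mxE mulr_ge0//.
  have /andP[e0 e1] := eta01 k.2.
  by rewrite mulr_ge0 ?sqr_ge0// subr_ge0 invf_ge1.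
have -> : x *m (sketch_dir k *m sketch_dir k) *m x^T =
    (x *m sketch_dir k) *m (x *m sketch_dir k)^T.
  by rewrite trmx_mul sketch_dir_sym !mulmxA.
by rewrite -vnorm_row_sqr sqr_ge0.
Qed.

End SketchedProduct.

Theorem theorem5p7 (R : realType) (N s m : nat)
    (P : 'M[R]_N) (U : 'M[R]_(N, s)) (Ud : 'M[R]_(N, m))
    (P_diag : is_diag_mx P) (P_gt0 : forall i : 'I_N, 0 < P i i)
    (U_orth : orthonormal_cols U) (Ud_orth : orthonormal_cols Ud)
    (c nu : nat) (c_gt0 : (0 < c)%N) (nu_gt0 : (0 < nu)%N)
    (eta_gt0 : forall i : 'I_N, 0 < eta U Ud c i)
    (d : measure_display) (T : measurableType d) (Pr : probability T R)
    (gam : 'I_nu -> 'I_N -> {RV Pr >-> bool})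
    (gam_bernoulli : forall (t : 'I_nu) (i : 'I_N),
       distribution Pr (gam t i) =1 bernoulli_prob (eta U Ud c i))
    (gam_indep : mutually_independent
       (fun ti : 'I_nu * 'I_N => gam ti.1 ti.2))
    (eps : R) (eps_gt0 : 0 < eps) :
  let V := Vmx P U Ud c nu in
  let L := Lconst P U Ud c nu in
  (Pr [set w | (eps <= spectral_norm
                 (Zbar P U Ud c (fun t i => gam t i w) - Zmx P U Ud))%R]
   <= (2 * (\tr V / spectral_norm V) *
       expR (- ((eps ^+ 2 / 2) / (spectral_norm V + L * eps / 3))))%:E)%E.
Proof.
cbv zeta; set V := Vmx _ _ _ _ _; set L := Lconst _ _ _ _ _.
have Vsym : V^T = V by exact: Vmx_sym.
have Vpsd (x : 'rV[R]_(s + m)) : 0 <= (x *m V *m x^T) 0 0 by exact: Vmx_psd.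
pose et := sketch_prob R N s m U Ud c nu.
pose be := sketch_scale R N s m P U Ud nu.
pose B := sketch_dir R N s m U Ud nu.
have et01 k : 0 < et k <= 1 by rewrite /et /sketch_prob eta_gt0 ge_min lexx.
pose W := bernoulli_weight R _ et.
have W0 g : 0 <= W g by exact: bernoulli_weight_ge0.
pose Y g := bernoulli_series R _ _ B et be g.
pose Q (g : {ffun 'I_nu * 'I_N -> bool}) :=
  eps <= spectral_norm (Zbar P U Ud c (fun t i => g (t, i)) - Zmx P U Ud).
pose p := \sum_(g | Q g) W g.
have Pr_le : (Pr [set w | (eps <= spectral_norm
    (Zbar P U Ud c (fun t i => gam t i w) - Zmx P U Ud))%R] <= p%:E)%E.
  have -> : [set w | (eps <= spectral_norm
      (Zbar P U Ud c (fun t i => gam t i w) - Zmx P U Ud))%R] =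
      [set w | Q [ffun k => gam k.1 k.2 w]].
    have gE w : (fun t i => [ffun k : 'I_nu * 'I_N => gam k.1 k.2 w : bool] (t, i)) =
        (fun t i => gam t i w).
      by apply/funext => t; apply/funext => i; rewrite ffunE.
    by apply/seteqP; split=> w /=; rewrite /Q gE.
  apply: pr_bernoulli_event_le => //.
  by move=> k; have /andP[/ltW-> ->] := et01 k.
apply: (le_trans Pr_le); rewrite lee_fin.
have p1 : p <= 1.
  rewrite -(sum_bernoulli_weight R _ et) [leRHS](bigID Q)/= lerDl.
  by apply: sumr_ge0 => g _; exact: W0.
have YE (g : {ffun 'I_nu * 'I_N -> bool}) :
    dilation R s m (Zbar P U Ud c (fun t i => g (t, i)) - Zmx P U Ud) = Y g.
  exact: dilation_sketch_error.
have VE : bernoulli_variance R _ _ B et be = V by exact: sketch_variance.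
(* Patterns outside [Q] contribute nonnegatively because dilations have trace zero. *)
have markov th : 0 <= th -> p * (expR (th * eps) - 1 - th * eps) <=
    \sum_g W g * (\tr (mexp R (s + m) (th *: Y g)) - (s + m)%:R).
  move=> th0; rewrite [leRHS](bigID Q)/= mulr_suml -[leLHS]addr0 lerD//.
    apply: ler_sum => g Qg; rewrite ler_wpM2l// -YE.
    exact: mxtrace_mexp_dilation_ge.
  apply: sumr_ge0 => g _; rewrite mulr_ge0// subr_ge0 -YE.
  apply: mxtrace_mexp_ge; first by rewrite linearZ/= dilation_sym.
  by rewrite mxtraceZ mxtrace_dilation mulr0.
(* Upper bounds [v] and [L'] replace the exact values so that a vanishing norm is covered as
   well. *)
have mgf v L' th : spectral_norm V <= v -> 0 < v -> L <= L' -> 0 < L' -> 0 <= th ->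
    p * (expR (th * eps) - 1 - th * eps) <=
    \tr V / v * (expR (v * ((expR (th * L') - 1 - th * L') / L' ^+ 2)) - 1).
  move=> Vv v0 LL' L'0 th0; apply: (le_trans (markov _ th0)).
  rewrite -VE.
  apply: (bernoulli_series_mgf _ _ _ _ _ _ _ _ _ _ _ _ _ (dilation_flip R s m)) => //.
  - exact: sketch_dir_sym.
  - by move=> k; apply: (sketch_dir_cube _ _ _ _ _ _ c).
  - by move=> k; apply: (sketch_scale_ge0 _ _ _ _ _ _ _ c).
  - by move=> k etk; rewrite (le_trans _ LL')// sketch_scale_le_Lconst.
  - exact: dilation_flip_sym.
  - exact: dilation_flip_sqr.
  - exact: sketch_dir_odd.
  - move=> x; rewrite VE.
    rewrite (le_trans (quad_le_spectral_norm _ _ _ Vsym Vpsd x))//.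
    by rewrite ler_wpM2r// -vnorm_row_sqr sqr_ge0.
have v_ge0 : 0 <= spectral_norm V by exact: spectral_norm_ge0.
have vtr : spectral_norm V <= \tr V by exact: spectral_norm_le_mxtrace.
have [v0|v_neq0] := eqVneq (spectral_norm V) 0.
  (* Here the quotient in the claim is [0 / 0 = 0], so [p] itself must be shown to vanish; any
     positive [v], [L'] and [th] will do. *)
  have tr0 : \tr V = 0 by exact: spectral_norm_eq0_mxtrace.
  have := mgf 1 (L + 1) 1; rewrite v0 tr0 !mul0r mul1r mulr0 mul0r.
  have L0 : 0 <= L by exact: Lconst_ge0.
  rewrite lerDl ltr_wpDl// !ler01 ltr01 => /(_ isT isT isT isT isT).
  have e0 : 0 < expR eps - 1 - eps.
    by rewrite -addrA -opprD subr_gt0 expR_gt1Dx// gt_eqF.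
  by rewrite pmulr_lle0.
have v0 : 0 < spectral_norm V by rewrite lt_def v_neq0.
have L0 : 0 < L.
  (* For [N = 0] the variance would be an empty sum, against the positivity of its norm. *)
  case: (pickP (@predT 'I_N)) => [i _|N0]; first exact: Lconst_gt0.
  move: vtr; rewrite leNgt => /negP[]; rewrite (_ : \tr V = 0)//.
  rewrite -VE /bernoulli_variance big1 ?raddf0//.
  by move=> k _; have := N0 k.2.
apply: bernstein_tail => //; apply: mgf => //.
have [eps_ge0 L_ge0] := (ltW eps_gt0, ltW L0).
by rewrite divr_ge0// addr_ge0// divr_ge0// mulr_ge0.
Qed.
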